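(* Let $\Delta t>0$, $T>0$ and $N_T=\lfloor T/\Delta t\rfloor$, set $t^n=n\Delta t$ and $\gamma=1-1/\sqrt2$. For each $\varepsilon>0$ let $(\mathbf{x}^n_\varepsilon,\mathbf{w}^n_\varepsilon,e^n_\varepsilon)_{0\le n\le N_T}$ (with values in $\mathbb{R}^2\times\mathbb{R}^2\times\mathbb{R}$) be a sequence obtained by the two-stage semi-implicit scheme described in the context, and assume that - for all $1\le n\le N_T$, $(\mathbf{x}^n_\varepsilon,\varepsilon\mathbf{w}^n_\varepsilon,e^n_\varepsilon)_{\varepsilon>0}$ is uniformly bounded with respect to $\varepsilon>0$; - $(\mathbf{x}^0_\varepsilon,\mathbf{w}^0_\varepsilon,e^0_\varepsilon)_{\varepsilon>0}$ converges as $\varepsilon\to0$ to some $(\mathbf{y}^0,\mathbf{w}^0,g^0)$. Then, for any $1\le n\le N_T$, $(\mathbf{x}^n_\varepsilon,e^n_\varepsilon)_{\varepsilon>0}$ converges to some $(\mathbf{y}^n,g^n)$ as $\varepsilon\to0$, and the limiting sequence $(\mathbf{y}^n,g^n)_{1\le n\le N_T}$ solves (for $1\le n\le N_T-1$) $$ \left\{ \begin{array}{l} \mathbf{y}^{n+1}=\mathbf{y}^n+(1-\gamma)\Delta t\,\mathbf{U}^n+\gamma\Delta t\,\mathbf{U}^{(1)},\\[0.5em] g^{n+1}=g^n+(1-\gamma)\Delta t\,T^n+\gamma\Delta t\,T^{(1)}, \end{array}\right. $$ where $$ \mathbf{U}^n=-\frac{1}{b(t^n,\mathbf{y}^n)}\Big(\mathbf{E}(t^n,\mathbf{y}^n)-g^n\nabla_{\mathbf{y}}(\ln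 b)(t^n,\mathbf{y}^n)\Big)^\perp,\qquad T^n=g^n\,\frac{\nabla_{\mathbf{y}}^\perp b}{b^2}(t^n,\mathbf{y}^n)\cdot\mathbf{E}(t^n,\mathbf{y}^n), $$ $$ \mathbf{U}^{(1)}=-\frac{1}{b(\hat t^{(1)},\hat{\mathbf{y}}^{(1)})}\Big(\mathbf{E}(\hat t^{(1)},\hat{\mathbf{y}}^{(1)})-\hat g^{(1)}\nabla_{\mathbf{y}}(\ln b)(\hat t^{(1)},\hat{\mathbf{y}}^{(1)})\Big)^\perp,\qquad T^{(1)}=\hat g^{(1)}\,\frac{\nabla_{\mathbf{y}}^\perp b}{b^2}(\hat t^{(1)},\hat{\mathbf{y}}^{(1)})\cdot\mathbf{E}(\hat t^{(1)},\hat{\mathbf{y}}^{(1)}), $$ with $\hat t^{(1)}=t^n+\Delta t/(2\gamma)$, $\hat{\mathbf{y}}^{(1)}=\mathbf{y}^n+\frac{\Delta t}{2\gamma}\mathbf{U}^n$, $\hat g^{(1)}=g^n+\frac{\Delta t}{2\gamma}T^n$; and this provides a consistent second-order approximation (with respect to $\Delta t$) of the gyro-kinetic system $$ \frac{\mathrm{d}\mathbf{Y}}{\mathrm{d}t}=\mathbf{F}(t,\mathbf{Y})+g\,\frac{\nabla_{\mathbf{x}}^\perp b}{b^2}(t,\mathbf{Y}),\qquad \frac{\mathrm{d}g}{\mathrm{d}t}=-\mathrm{div}_{\mathbf{x}}(\mathbf{F})(t,\mathbf{Y})\,g,\qquad \mathbf{F}:=-\frac{1}{b}\mathbf{E}^\perp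 . $$
   Context: For $\mathbf{a}=(a_1,a_2)\in\mathbb{R}^2$, $\mathbf{a}^\perp=(-a_2,a_1)$; $\nabla^\perp b=(\nabla b)^\perp=(-\partial_{x_2}b,\partial_{x_1}b)$, where gradients and divergences are with respect to the space variable. The fields $\mathbf{E}:\mathbb{R}^+\times\mathbb{R}^2\to\mathbb{R}^2$ and $b:\mathbb{R}^+\times\mathbb{R}^2\to\mathbb{R}$ are given, smooth and independent of $\varepsilon$; there is $b_0>0$ such that $b(t,\mathbf{x})\ge b_0$ for all $(t,\mathbf{x})\in\mathbb{R}^+\times\mathbb{R}^2$; and $\mathbf{E}=-\nabla_{\mathbf{x}}\phi$ derives from a potential $\phi$ (so $\partial_{x_1}E_2-\partial_{x_2}E_1=0$). The function $\chi:\mathbb{R}\times\mathbb{R}^2\to\mathbb{R}$ is continuous and satisfies: $\chi(\tfrac12\|\mathbf{w}\|^2,\mathbf{w})=0$ for all $\mathbf{w}\in\mathbb{R}^2$; $\lim_{\mathbf{w}\to0}\chi(e,\mathbf{w})=e$ for all $e\in\mathbb{R}$; $0\le\chi(e,\mathbf{w})\le e$ for all $(e,\mathbf{w})\in\mathbb{R}_+\times\mathbb{R}^2$. **Scheme.** $\gamma=1-1/\sqrt2$ is the smallest root of $X^2-2X+1/2$. Given $(\mathbf{x}^n,\mathbf{w}^n,e^n)$, the first stage $(\mathbf{x}^{(1)},\mathbf{w}^{(1)},e^{(1)})$ is defined by $$\mathbf{x}^{(1)}=\mathbf{x}^n+\tfrac{\gamma\Delta t}{\varepsilon}\mathbf{w}^{(1)},\quad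 e^{(1)}=e^n+\tfrac{\gamma\Delta t}{\varepsilon}S^{(1)},\quad \mathbf{w}^{(1)}=\mathbf{w}^n+\tfrac{\gamma\Delta t}{\varepsilon}\mathbf{F}^{(1)},$$ $$\mathbf{F}^{(1)}=\mathbf{E}(t^n,\mathbf{x}^n)-\chi(e^n,\mathbf{w}^n)\nabla_{\mathbf{x}}(\ln b)(t^n,\mathbf{x}^n)-b(t^n,\mathbf{x}^n)\frac{(\mathbf{w}^{(1)})^\perp}{\varepsilon},\quad S^{(1)}=\mathbf{E}(t^n,\mathbf{x}^n)\cdot\mathbf{w}^{(1)}.$$ Set $\hat t^{(1)}=t^n+\Delta t/(2\gamma)$ and $$\hat{\mathbf{x}}^{(1)}=\mathbf{x}^n+\tfrac{\Delta t}{2\gamma\varepsilon}\mathbf{w}^{(1)},\quad \hat e^{(1)}=e^n+\tfrac{\Delta t}{2\gamma\varepsilon}S^{(1)},\quad \hat{\mathbf{w}}^{(1)}=\mathbf{w}^n+\tfrac{\Delta t}{2\gamma\varepsilon}\mathbf{F}^{(1)}.$$ The second stage $(\mathbf{x}^{(2)},\mathbf{w}^{(2)},e^{(2)})$ is defined by $$\mathbf{x}^{(2)}=\mathbf{x}^n+\tfrac{(1-\gamma)\Delta t}{\varepsilon}\mathbf{w}^{(1)}+\tfrac{\gamma\Delta t}{\varepsilon}\mathbf{w}^{(2)},\quad e^{(2)}=e^n+\tfrac{(1-\gamma)\Delta t}{\varepsilon}S^{(1)}+\tfrac{\gamma\Delta t}{\varepsilon}S^{(2)},\quad \mathbf{w}^{(2)}=\mathbf{w}^n+\tfrac{(1-\gamma)\Delta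 t}{\varepsilon}\mathbf{F}^{(1)}+\tfrac{\gamma\Delta t}{\varepsilon}\mathbf{F}^{(2)},$$ $$\mathbf{F}^{(2)}=\mathbf{E}(\hat t^{(1)},\hat{\mathbf{x}}^{(1)})-\chi(\hat e^{(1)},\hat{\mathbf{w}}^{(1)})\nabla_{\mathbf{x}}(\ln b)(\hat t^{(1)},\hat{\mathbf{x}}^{(1)})-b(\hat t^{(1)},\hat{\mathbf{x}}^{(1)})\frac{(\mathbf{w}^{(2)})^\perp}{\varepsilon},\quad S^{(2)}=\mathbf{E}(\hat t^{(1)},\hat{\mathbf{x}}^{(1)})\cdot\mathbf{w}^{(2)}.$$ Finally $\mathbf{x}^{n+1}=\mathbf{x}^{(2)}$, $e^{n+1}=e^{(2)}$, $\mathbf{w}^{n+1}=\mathbf{w}^{(2)}$. A one-step scheme is a consistent approximation of order $p$ of an ODE system if, applying one step of size $\Delta t$ of the scheme to the value at time $t^n$ of a smooth exact solution, the result differs from the exact solution at time $t^n+\Delta t$ by $O(\Delta t^{p+1})$ as $\Delta t\to0$. *)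

(* Defs.v *)
From HB Require Import structures.
From mathcomp Require Import all_boot all_order all_algebra.
From mathcomp Require Import all_classical all_reals all_analysis.

Set Implicit Arguments.
Unset Strict Implicit.
Unset Printing Implicit Defensive.

Import Order.TTheory GRing.Theory Num.Theory.
Import numFieldNormedType.Exports.

Local Open Scope classical_set_scope.
Local Open Scope ring_scope.

(* The library norm `|_| on 'rV[R]_2 and on products is the sup norm; the
   squared Euclidean norm of w is dot w w. *)

Section PlaneCalculus.
Context {R : realType}.

Definition dot (u v : 'rV[R]_2) : R := \sum_(i < 2) u 0 i * v 0 i.

Definition perp (a : 'rV[R]_2) : 'rV[R]_2 :=
  \row_(i < 2) (if i == 0 then - a 0 1 else a 0 0).

Definition grad (f : 'rV[R]_2 -> R) (x : 'rV[R]_2) : 'rV[R]_2 :=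
  \row_(i < 2) 'D_(delta_mx 0 i) f x.

Definition perp_grad (f : 'rV[R]_2 -> R) (x : 'rV[R]_2) : 'rV[R]_2 :=
  perp (grad f x).

Definition divergence (G : 'rV[R]_2 -> 'rV[R]_2) (x : 'rV[R]_2) : R :=
  \sum_(i < 2) 'D_(delta_mx 0 i) (fun y => G y 0 i) x.

End PlaneCalculus.

Section Smoothness.
Context {R : realType}.

(* Class C^k on a whole space V. It is the usual class C^k when V is finite
   dimensional, the only case used below. *)
Fixpoint classC (V W : normedModType R) (k : nat) (f : V -> W) : Prop :=
  match k with
  | 0 => continuous f
  | k'.+1 => (forall x, differentiable f x) /\
             (forall v, classC k' (fun x => 'D_v f x))
  end.

Definition smooth (V W : normedModType R) (f : V -> W) : Prop :=
  forall k, classC k f.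

(* Smoothness on a closed set D (a half-space or a segment below), up to its
   boundary: f is the restriction to D of a smooth function. *)
Definition smooth_on (V W : normedModType R) (D : set V) (f : V -> W) : Prop :=
  exists2 g : V -> W, smooth g & forall x, D x -> f x = g x.

End Smoothness.

Section Scheme.
Context {R : realType}.
Variables (E : R -> 'rV[R]_2 -> 'rV[R]_2) (b : R -> 'rV[R]_2 -> R).
Variable chi : R -> 'rV[R]_2 -> R.

Definition gamma : R := 1 - (Num.sqrt 2)^-1.

Definition grad_ln_b (t : R) (x : 'rV[R]_2) : 'rV[R]_2 :=
  grad (fun y => ln (b t y)) x.

(* The time-explicit quantities are (t, x, w, e); only the magnetic term is
   taken at the unknown velocity wi of the stage. *)
Definition force (eps t : R) (x w : 'rV[R]_2) (e : R) (wi : 'rV[R]_2) :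
    'rV[R]_2 :=
  E t x - chi e w *: grad_ln_b t x - b t x *: (eps^-1 *: perp wi).

Definition scheme_step (eps dt t : R) (x w : 'rV[R]_2) (e : R)
    (x' w' : 'rV[R]_2) (e' : R) : Prop :=
  exists (x1 w1 : 'rV[R]_2) (e1 : R),
  let F1 := force eps t x w e w1 in
  let S1 := dot (E t x) w1 in
  let th := t + dt / (2 * gamma) in
  let xh := x + (dt / (2 * gamma * eps)) *: w1 in
  let eh := e + dt / (2 * gamma * eps) * S1 in
  let wh := w + (dt / (2 * gamma * eps)) *: F1 in
  let F2 := force eps th xh wh eh w' in
  let S2 := dot (E th xh) w' in
  [/\ x1 = x + (gamma * dt / eps) *: w1,
      e1 = e + gamma * dt / eps * S1 &
      w1 = w + (gamma * dt / eps) *: F1] /\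
  [/\ x' = x + ((1 - gamma) * dt / eps) *: w1 + (gamma * dt / eps) *: w',
      e' = e + (1 - gamma) * dt / eps * S1 + gamma * dt / eps * S2 &
      w' = w + ((1 - gamma) * dt / eps) *: F1 + (gamma * dt / eps) *: F2].

Definition limit_U (t : R) (y : 'rV[R]_2) (g : R) : 'rV[R]_2 :=
  - (b t y)^-1 *: perp (E t y - g *: grad_ln_b t y).

Definition limit_T (t : R) (y : 'rV[R]_2) (g : R) : R :=
  g * dot ((b t y ^+ 2)^-1 *: perp_grad (b t) y) (E t y).

Definition limit_step (dt t : R) (z : 'rV[R]_2 * R) : 'rV[R]_2 * R :=
  let: (y, g) := z in
  let U := limit_U t y g in
  let T := limit_T t y g in
  let th := t + dt / (2 * gamma) in
  let yh := y + (dt / (2 * gamma)) *: U in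
  let gh := g + dt / (2 * gamma) * T in
  let U1 := limit_U th yh gh in
  let T1 := limit_T th yh gh in
  (y + ((1 - gamma) * dt) *: U + (gamma * dt) *: U1,
   g + (1 - gamma) * dt * T + gamma * dt * T1).

Definition drift (t : R) (x : 'rV[R]_2) : 'rV[R]_2 :=
  - (b t x)^-1 *: perp (E t x).

Definition gyrokinetic_rhs (t : R) (z : 'rV[R]_2 * R) : 'rV[R]_2 * R :=
  let: (y, g) := z in
  (drift t y + g *: ((b t y ^+ 2)^-1 *: perp_grad (b t) y),
   - divergence (drift t) y * g).

End Scheme.

Section Consistency.
Context {R : realType} {V : normedModType R}.

(* step h t is one step of size h started at time t. The constant is uniform
   over the starting times t in the interval of existence of the solution, so
   that t may be a grid time n * h that varies with h. *)
Definition consistent_of_order (p : nat) (step : R -> R -> V -> V)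
    (rhs : R -> V -> V) : Prop :=
  forall (t0 t1 : R) (z : R -> V),
    0 <= t0 -> t0 < t1 ->
    smooth_on `[t0, t1] z ->
    (forall t, t0 < t < t1 -> is_derive t 1 z (rhs t (z t))) ->
    exists C : R, \forall h \near 0^'+, forall t, t0 <= t -> t + h <= t1 ->
      `|step h t (z t) - z (t + h)| <= C * h ^+ p.+1.

End Consistency.

(* Main.v *)
Require Import Defs.
From HB Require Import structures.
From mathcomp Require Import all_boot all_order all_algebra.
From mathcomp Require Import all_classical all_reals all_analysis.
From mathcomp Require Import ring lra zify.

Set Implicit Arguments.
Unset Strict Implicit.
Unset Printing Implicit Defensive.

Import Order.TTheory GRing.Theory Num.Theory.
Import numFieldNormedType.Exports.

Local Open Scope classical_set_scope.
Local Open Scope ring_scope.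

(** Both claims rest on one change of unknown and one comparison.

    Convergence.  Write u = w / eps for the velocity of a stage.  Multiplied by
    eps, each implicit stage becomes eps^2 u + c b u^perp = eps q + c G, where c
    is gamma dt, G is the explicit part of the force and q gathers the previous
    velocities.  The operator on the left is a rotation plus a small multiple of
    the identity, and b stays away from 0, so u tends to - G^perp / b as soon as
    eps q tends to 0 ([implicit_stage_cvg]).  Hence positions and energies
    converge over a step, and the final velocity w = eps u tends to 0
    ([scheme_step_cvg]).  After the first step all velocities entering chi thus
    tend to 0, where chi e 0 = e, and since E^perp is orthogonal to E the limit
    equations are exactly the limit scheme ([scheme_advance], [scheme_cvg]).

    Consistency.  As E derives from a potential it is curl free
    ([derive_comm], [curl_free]), so the gyro-kinetic right-hand side is
    (limit_U, limit_T) ([gyrokinetic_rhsE]).  The limit scheme is the explicit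
    two-stage Runge-Kutta method with weights 1 - gamma, gamma and second node
    kap = 1 / (2 gamma), for which gamma kap = 1/2 is the order-two condition.
    To compare with a solution Z, the second stage is evaluated on the solution
    itself at time t + kap h: the predictor is within O(h^2) of Z (t + kap h)
    and the right-hand side is Lipschitz on compact sets, so the second slope is
    Z' (t + kap h) + O(h^2), and the rest is the Taylor expansion of Z alone
    ([two_stage_consistent]).

    Since kap > 1, the node t + kap h can lie beyond the last time t1 where Z
    solves the system.  There the defect Z' - f(., Z) of a smooth extension of Z
    vanishes on the left of t1 and is differentiable twice at t1, so it is
    O((s - t1)^2) ([quadratic_vanishing]), which is again O(h^2). *)

(** * Plane vectors and spatial slices *)

Section Plane.
Context {R : realType}.
Implicit Types (u v y : 'rV[R]_2) (a k t : R).

Lemma rV2P u v : u 0 0 = v 0 0 -> u 0 1 = v 0 1 -> u = v.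
Proof.
move=> h0 h1; apply/rowP => i; case: i => [[|[|//]] i2].
- by rewrite (_ : Ordinal i2 = 0) //; apply: val_inj.
- by rewrite (_ : Ordinal i2 = 1) //; apply: val_inj.
Qed.

Lemma dotE u v : dot u v = u 0 0 * v 0 0 + u 0 1 * v 0 1.
Proof.
by rewrite /dot big_ord_recl big_ord1 (_ : lift _ _ = 1) //; apply: val_inj.
Qed.

Lemma perp0E u : perp u 0 0 = - u 0 1.
Proof. by rewrite mxE. Qed.

Lemma perp1E u : perp u 0 1 = u 0 0.
Proof. by rewrite mxE. Qed.

Lemma rV2_delta u : u = u 0 0 *: delta_mx 0 0 + u 0 1 *: delta_mx 0 1.
Proof. by apply: rV2P; rewrite !mxE /=; ring. Qed.

Lemma cvg_rV2 {T : Type} (F : set_system T) {FF : Filter F}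
    (f : T -> 'rV[R]_2) u :
  f x 0 0 @[x --> F] --> u 0 0 -> f x 0 1 @[x --> F] --> u 0 1 ->
  f @ F --> u.
Proof.
move=> h0 h1; rewrite [u]rV2_delta.
rewrite (_ : f = fun x => f x 0 0 *: delta_mx 0 0 + f x 0 1 *: delta_mx 0 1).
  by apply: cvgD; apply: cvgZr_tmp.
by apply/funext => x; exact: rV2_delta.
Qed.

Lemma cvg_rV2_coord {T : Type} (F : set_system T) {FF : Filter F}
    (f : T -> 'rV[R]_2) u i :
  f @ F --> u -> f x 0 i @[x --> F] --> u 0 i.
Proof.
move=> fu.
exact: (cvg_comp _ _ fu (@coord_continuous R 1 2 0 i u)).
Qed.

Lemma cvg_perp {T : Type} (F : set_system T) {FF : Filter F}
    (f : T -> 'rV[R]_2) u :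
  f @ F --> u -> perp (f x) @[x --> F] --> perp u.
Proof.
move=> fu; apply: cvg_rV2.
- under eq_fun do rewrite perp0E.
  by rewrite perp0E; apply: cvgN; exact: cvg_rV2_coord.
- under eq_fun do rewrite perp1E.
  by rewrite perp1E; exact: cvg_rV2_coord.
Qed.

Lemma cvg_dot {T : Type} (F : set_system T) {FF : Filter F}
    (f g : T -> 'rV[R]_2) u v :
  f @ F --> u -> g @ F --> v -> dot (f x) (g x) @[x --> F] --> dot u v.
Proof.
move=> fu gv; rewrite dotE; under eq_fun do rewrite dotE.
by apply: cvgD; apply: cvgM; exact: cvg_rV2_coord.
Qed.

Lemma perpZ a u : perp (a *: u) = a *: perp u.
Proof. by apply: rV2P; rewrite !mxE /= ?mulrN. Qed.

Lemma dotZr a u v : dot u (a *: v) = a * dot u v.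
Proof. by rewrite !dotE !mxE; ring. Qed.

Lemma norm_rV2_le u a : `|u 0 0| <= a -> `|u 0 1| <= a -> `|u| <= a.
Proof.
move=> h0 h1; have a0 : 0 <= a by exact: le_trans h0.
rewrite [leLHS]/Num.Def.normr /= mx_normrE (bigmax_le _ a0) //= => -[i j] _ /=.
rewrite (ord1 i).
case: j => [[|[|//]] i2].
- by rewrite (_ : Ordinal i2 = 0) //; apply: val_inj.
- by rewrite (_ : Ordinal i2 = 1) //; apply: val_inj.
Qed.

Lemma coord_le_norm u i : `|u 0 i| <= `|u|.
Proof.
rewrite [leRHS]/Num.Def.normr /= mx_normrE.
exact: (le_bigmax _ (fun i : 'I_1 * 'I_2 => `|u i.1 i.2|) (0, i)).
Qed.

Lemma combination_coord (k l : R) (u v1 v2 v3 : 'rV[R]_2) i :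
  (u + k *: v1 + l *: v2 - v3) 0 i = u 0 i + k * v1 0 i + l * v2 0 i - v3 0 i.
Proof. by rewrite !mxE. Qed.

Lemma derive_slice (W : normedModType R) (F : R * 'rV[R]_2 -> W) t y v :
  'D_v (fun x => F (t, x)) y = 'D_((0, v) : R * 'rV[R]_2) F (t, y).
Proof.
rewrite /derive; set f := (X in lim (X @ _)); set g := (X in _ = lim (X @ _)).
suff -> : f = g by []; apply/funext => h; rewrite /f /g /=.
rewrite (_ : h *: ((0, v) : R * 'rV[R]_2) + (t, y) = (t, h *: v + y)) //.
by apply: injective_projections; rewrite /= ?scaler0 ?add0r.
Qed.

Lemma differentiable_slice (W : normedModType R) (F : R * 'rV[R]_2 -> W) t y :
  differentiable F (t, y) -> differentiable (fun x => F (t, x)) y.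
Proof.
move=> dF; apply: (@differentiable_comp _ _ _ _ (fun x => (t, x)) F) => //.
Qed.

Lemma is_derive_ln (V : normedModType R) (f : V -> R) (x v : V) :
  differentiable f x -> 0 < f x ->
  is_derive x v (fun z => ln (f z)) ((f x)^-1 * 'D_v f x).
Proof.
move=> df fx0.
have dln : differentiable (@ln R) (f x).
  by apply/derivable1_diffP; exact: (@ex_derive _ _ _ _ _ _ _ (is_derive1_ln fx0)).
have dc : differentiable (@ln R \o f) x by exact: differentiable_comp.
apply: DeriveDef; first exact: diff_derivable.
rewrite (deriveE _ dc) (diff_comp df dln) /= (deriveE _ df).
rewrite deriv1E; last exact/derivable1_diffP.
by rewrite derive1E (@derive_val _ _ _ _ _ _ _ (is_derive1_ln fx0)) mulrC.
Qed.

End Plane.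

(** * One stiff implicit stage *)

Section StiffStage.
Context {R : realType}.
Implicit Types (u v y : 'rV[R]_2) (t c : R).

(** With the plane seen as the complex numbers, perp is multiplication by i, and
    this is division by a + i B. *)
Lemma solve_rotation u v (a B : R) : a ^+ 2 + B ^+ 2 != 0 ->
  a *: u + B *: perp u = v ->
  u = (a ^+ 2 + B ^+ 2)^-1 *: (a *: v - B *: perp v).
Proof.
move=> nz <-; apply: rV2P; rewrite !mxE /=; field.
- exact: nz.
- exact: nz.
Qed.

Lemma cvg_at_right_id : eps @[eps --> (0 : R)^'+] --> (0 : R).
Proof. by apply: cvg_at_right_filter; exact: cvg_id. Qed.

Lemma near_at_right_eq (W : normedModType R) (f g : R -> W) (l : W) :
  (forall eps, 0 < eps -> f eps = g eps) ->
  g @ 0^'+ --> l -> f @ 0^'+ --> l.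
Proof.
move=> fg; apply: cvg_trans; apply: near_eq_cvg.
by near=> eps; rewrite fg.
Unshelve. all: by end_near. Qed.

(** The coefficient of the identity vanishes in the limit, but the rotation part
    keeps the operator invertible with a bounded inverse; only the inverse
    of beta perp survives. *)
Lemma cvg_rotation (B : R -> R) (A u : R -> 'rV[R]_2) (beta : R) a :
  beta != 0 -> B @ 0^'+ --> beta -> A @ 0^'+ --> a ->
  (forall eps, 0 < eps ->
     eps ^+ 2 *: u eps + B eps *: perp (u eps) = A eps) ->
  u @ 0^'+ --> - beta^-1 *: perp a.
Proof.
move=> beta0 Bb Aa eq.
have e2 : eps ^+ 2 @[eps --> (0 : R)^'+] --> (0 : R).
  rewrite -[X in _ --> X](expr0n R 2); under eq_fun do rewrite expr2.
  by rewrite expr2; apply: cvgM; exact: cvg_at_right_id.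
apply: (@near_at_right_eq _ _ (fun eps => ((eps ^+ 2) ^+ 2 + B eps ^+ 2)^-1 *:
          (eps ^+ 2 *: A eps - B eps *: perp (A eps)))).
  move=> eps eps0; apply: solve_rotation (eq _ eps0).
  by rewrite gt_eqF // ltr_pwDl ?exprn_gt0 // sqr_ge0.
rewrite (_ : - beta^-1 *: perp a =
  (0 ^+ 2 + beta ^+ 2)^-1 *: (0 *: a - beta *: perp a)); last first.
  by rewrite scale0r sub0r expr0n add0r scalerN scalerA scaleNr; congr (- (_ *: _)); field.
apply: cvgZ.
- apply: cvgV; first by rewrite expr0n add0r sqrf_eq0.
  by apply: cvgD; under eq_fun do rewrite expr2; rewrite expr2; apply: cvgM.
- by apply: cvgB; apply: cvgZ => //; exact: cvg_perp.
Qed.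

Context (E : R -> 'rV[R]_2 -> 'rV[R]_2) (b : R -> 'rV[R]_2 -> R).

(** Multiplied by eps, the stage is a rotation equation for w / eps whose source
    eps q + c G tends to c G, where G is the explicit force with chi
    replaced by its limit kappa. *)
Lemma implicit_stage_cvg t c (x q w : R -> 'rV[R]_2) (k : R -> R) y kappa :
  0 < c -> b t y != 0 ->
  {for y, continuous (E t)} -> {for y, continuous (b t)} ->
  {for y, continuous (grad_ln_b b t)} ->
  x @ 0^'+ --> y -> eps *: q eps @[eps --> 0^'+] --> (0 : 'rV[R]_2) ->
  k @ 0^'+ --> kappa ->
  (forall eps, 0 < eps -> w eps = q eps + (c / eps) *:
     (E t (x eps) - k eps *: grad_ln_b b t (x eps)
        - b t (x eps) *: (eps^-1 *: perp (w eps)))) ->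
  eps^-1 *: w eps @[eps --> 0^'+] --> limit_U E b t y kappa.
Proof.
move=> c0 by0 Ec bc lc xy q0 kk eq.
have Ex := cvg_comp _ _ xy Ec.
have bx := cvg_comp _ _ xy bc.
have lx := cvg_comp _ _ xy lc.
rewrite /limit_U.
rewrite (_ : - _ *: _ = - (c * b t y)^-1 *:
    perp (0 + c *: (E t y - kappa *: grad_ln_b b t y))); last first.
  rewrite add0r perpZ scalerA; congr (_ *: _); field.
  by rewrite by0 gt_eqF.
apply: (@cvg_rotation (fun eps => c * b t (x eps)) (fun eps => eps *: q eps +
   c *: (E t (x eps) - k eps *: grad_ln_b b t (x eps)))).
- by rewrite mulf_neq0 // gt_eqF.
- exact: cvgMl_tmp.
- apply: cvgD; first exact: q0.
  by apply: cvgZl_tmp; apply: cvgB; [exact: Ex|apply: cvgZ; [exact: kk|exact: lx]].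
- move=> eps eps0; rewrite scalerA expr2 -mulrA divff ?gt_eqF // mulr1.
  rewrite [in X in X + _](eq _ eps0).
  set G := E t _ - _; set v := w eps.
  by apply: rV2P; rewrite !mxE /=; field; rewrite gt_eqF.
Qed.

End StiffStage.

(** * The limit of one step of the scheme *)

Section SchemeLimit.
Context {R : realType}.
Implicit Types (u v y : 'rV[R]_2) (t : R).

Lemma gamma_gt0 : 0 < @gamma R.
Proof.
rewrite /gamma subr_gt0 invf_lt1 ?sqrtr_gt0 //.
by rewrite -[ltLHS]sqrtr1 ltr_sqrt // ltr1n.
Qed.

(** Properness is what makes limits at 0 along nonzero velocities unique. *)
Lemma punctured_nbhs0_proper : ProperFilter (0 : 'rV[R]_2)^'.
Proof.
apply: Build_ProperFilter_ex => P /nbhs_ballP [d /= d0 dP].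
pose v : 'rV[R]_2 := (d / 2) *: delta_mx 0 0.
have v0 : v 0 0 = d / 2 by rewrite !mxE /= mulr1.
exists v; apply: dP.
  rewrite -ball_normE /ball_ /= sub0r normrN.
  apply: (@le_lt_trans _ _ (d / 2)); last by lra.
  apply: norm_rV2_le; rewrite ?v0 ?mxE /= ?mulr0 ?normr0 ?ger0_norm; lra.
by apply/eqP => vE; move: v0; rewrite vE mxE; lra.
Qed.

Lemma cvg_curried (chi : R -> 'rV[R]_2 -> R) {T : Type} (F : set_system T)
    {FF : Filter F} (ee : T -> R) (ww : T -> 'rV[R]_2) el wl :
  continuous (fun p : R * 'rV[R]_2 => chi p.1 p.2) ->
  ee @ F --> el -> ww @ F --> wl ->
  chi (ee s) (ww s) @[s --> F] --> chi el wl.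
Proof.
move=> chic h1 h2.
exact: (cvg_comp _ _ (cvg_pair h1 h2) (chic (el, wl))).
Qed.

Lemma chi_at_rest (chi : R -> 'rV[R]_2 -> R) (e : R) :
  continuous (fun p : R * 'rV[R]_2 => chi p.1 p.2) ->
  chi e w @[w --> (0 : 'rV[R]_2)^'] --> e -> chi e 0 = e.
Proof.
move=> chic chil; have PF := punctured_nbhs0_proper.
have : chi e w @[w --> (0 : 'rV[R]_2)^'] --> chi e 0.
  rewrite /dnbhs; apply: cvg_within_filter.
  by apply: (cvg_curried chic (ee := fun=> e)); [exact: cvg_cst|exact: cvg_id].
by move=> h; apply: (cvg_unique _ h chil).
Qed.

Context (E : R -> 'rV[R]_2 -> 'rV[R]_2) (b : R -> 'rV[R]_2 -> R).
Context (chi : R -> 'rV[R]_2 -> R).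

(** The scheme in terms of the velocities divided by eps. The explicit force is
    eliminated through dt / eps F1 = (w1 - w) / gamma, which the first stage
    provides; the second stage then has the same implicit form as the first
    one, and no term of the predictor velocity has a negative power of eps. *)
Definition scaled_step eps dt t x w e x' w' e' (w1 : 'rV[R]_2) : Prop :=
  let k := dt / (2 * gamma) in
  let th := t + k in
  let xh := x + k *: (eps^-1 *: w1) in
  let eh := e + k * dot (E t x) (eps^-1 *: w1) in
  let wh := w + (2 * gamma ^+ 2)^-1 *: (w1 - w) in
  [/\ w1 = w + (gamma * dt / eps) *: force E b chi eps t x w e w1,
      w' = (w + ((1 - gamma) / gamma) *: (w1 - w))
             + (gamma * dt / eps) *: force E b chi eps th xh wh eh w',
      x' = x + ((1 - gamma) * dt) *: (eps^-1 *: w1)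
             + (gamma * dt) *: (eps^-1 *: w') &
      e' = e + (1 - gamma) * dt * dot (E t x) (eps^-1 *: w1)
             + gamma * dt * dot (E th xh) (eps^-1 *: w')].

Lemma scheme_step_scaled eps dt t x w e x' w' e' : 0 < eps ->
  scheme_step E b chi eps dt t x w e x' w' e' ->
  exists w1, scaled_step eps dt t x w e x' w' e' w1.
Proof.
move=> eps0 [x1 [w1 [e1 [[_ _ w1E] [x'E e'E w'E]]]]]; exists w1.
have g0 : @gamma R != 0 by rewrite gt_eqF // gamma_gt0.
have eps_neq0 : eps != 0 by rewrite gt_eqF.
set F1 := force E b chi eps t x w e w1 in w1E x'E e'E w'E *.
have F1E : (dt / eps) *: F1 = gamma^-1 *: (w1 - w).
  rewrite [in RHS]w1E addrAC subrr add0r scalerA; congr (_ *: _).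
  by field; rewrite eps_neq0.
have whE : w + (dt / (2 * gamma * eps)) *: F1
         = w + (2 * gamma ^+ 2)^-1 *: (w1 - w).
  congr (_ + _).
  rewrite (_ : dt / (2 * gamma * eps) = (2 * gamma)^-1 * (dt / eps)); last first.
    by field; rewrite eps_neq0.
  by rewrite -scalerA F1E scalerA; congr (_ *: _); field.
have xhE : x + (dt / (2 * gamma * eps)) *: w1
         = x + (dt / (2 * gamma)) *: (eps^-1 *: w1).
  by rewrite scalerA; congr (_ + _ *: _); field; rewrite eps_neq0.
have ehE : e + dt / (2 * gamma * eps) * dot (E t x) w1
         = e + dt / (2 * gamma) * dot (E t x) (eps^-1 *: w1).
  by rewrite dotZr; field; rewrite eps_neq0.
move: x'E e'E w'E; rewrite whE xhE ehE => x'E e'E w'E; split => //.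
- rewrite {1}w'E; congr (_ + _ + _).
  rewrite (_ : (1 - gamma) * dt / eps = (1 - gamma) * (dt / eps)); last by rewrite mulrA.
  by rewrite -scalerA F1E scalerA.
- by rewrite x'E !scalerA.
- by rewrite e'E !dotZr; ring.
Qed.

(** The velocity after the step is eps times a convergent drift, hence tends to
    0. Thus W = 0 at every step but the one from time 0; a general W is kept
    for that step, where it enters the limits through the values kap and
    kap1 of chi. *)
Lemma scheme_step_cvg dt t (x w x' w' : R -> 'rV[R]_2) (e e' : R -> R)
    y (W : 'rV[R]_2) (g : R) :
  let k := dt / (2 * gamma) in
  0 < dt ->
  (forall z, b t z != 0) -> (forall z, b (t + k) z != 0) ->
  continuous (E t) -> continuous (b t) -> continuous (grad_ln_b b t) ->
  continuous (E (t + k)) -> continuous (b (t + k)) ->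
  continuous (grad_ln_b b (t + k)) ->
  continuous (fun p : R * 'rV[R]_2 => chi p.1 p.2) ->
  (forall eps, 0 < eps -> scheme_step E b chi eps dt t
     (x eps) (w eps) (e eps) (x' eps) (w' eps) (e' eps)) ->
  x @ 0^'+ --> y -> w @ 0^'+ --> W -> e @ 0^'+ --> g ->
  let kap := chi g W in
  let U := limit_U E b t y kap in
  let yh := y + k *: U in
  let gh := g + k * dot (E t y) U in
  let kap1 := chi gh (W + (2 * gamma ^+ 2)^-1 *: (0 - W)) in
  let U1 := limit_U E b (t + k) yh kap1 in
  [/\ x' @ 0^'+ --> y + ((1 - gamma) * dt) *: U + (gamma * dt) *: U1,
      w' @ 0^'+ --> (0 : 'rV[R]_2) &
      e' @ 0^'+ --> g + (1 - gamma) * dt * dot (E t y) U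
                      + gamma * dt * dot (E (t + k) yh) U1].
Proof.
move=> k dt0 b0 bk0 Ec bc lc Ekc bkc lkc chic step xy wW eg kap U yh gh kap1 U1.
have /choice[w1 w1P] : forall eps, exists v, 0 < eps ->
    scaled_step eps dt t (x eps) (w eps) (e eps) (x' eps) (w' eps) (e' eps) v.
  move=> eps; have [eps0|_] := ltP 0 eps; last by exists 0.
  by have [v vP] := scheme_step_scaled eps0 (step _ eps0); exists v.
have c0 : 0 < gamma * dt by rewrite mulr_gt0 // gamma_gt0.
have small (q : R -> 'rV[R]_2) (l : 'rV[R]_2) :
    eps^-1 *: q eps @[eps --> 0^'+] --> l ->
    q @ 0^'+ --> (0 : 'rV[R]_2).
  move=> ql; rewrite -(scale0r l).
  apply: (@near_at_right_eq _ _ _ (fun eps => eps *: (eps^-1 *: q eps))).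
    by move=> eps eps0; rewrite scalerA divff ?gt_eqF // scale1r.
  by apply: cvgZ => //; exact: cvg_at_right_id.
have null (q : R -> 'rV[R]_2) (l : 'rV[R]_2) : q @ 0^'+ --> l ->
    eps *: q eps @[eps --> 0^'+] --> (0 : 'rV[R]_2).
  by move=> ql; rewrite -(scale0r l); apply: cvgZ => //; exact: cvg_at_right_id.
have uU : eps^-1 *: w1 eps @[eps --> 0^'+] --> U.
  apply: (implicit_stage_cvg c0 _ _ _ _ xy (null _ _ wW) (cvg_curried chic eg wW)) => //.
  - exact: Ec.
  - exact: bc.
  - exact: lc.
  - by move=> eps eps0; have [] := w1P _ eps0.
clearbody U; have w10 := small _ _ uU.
have Ex := cvg_comp _ _ xy (Ec y).
have s1 := cvg_dot Ex uU.
have xhc : x eps + k *: (eps^-1 *: w1 eps) @[eps --> 0^'+] --> yh.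
  by apply: cvgD; [exact: xy|apply: cvgZl_tmp; exact: uU].
have ehc : e eps + k * dot (E t (x eps)) (eps^-1 *: w1 eps) @[eps --> 0^'+] --> gh.
  apply: cvgD; first exact: eg.
  by apply: cvgMl_tmp; exact: s1.
have whc : w eps + (2 * gamma ^+ 2)^-1 *: (w1 eps - w eps) @[eps --> 0^'+]
    --> W + (2 * gamma ^+ 2)^-1 *: (0 - W).
  by apply: cvgD; [exact: wW|apply: cvgZl_tmp; apply: cvgB; [exact: w10|exact: wW]].
have uU1 : eps^-1 *: w' eps @[eps --> 0^'+] --> U1.
  have kapc : chi (e s + k * dot (E t (x s)) (s^-1 *: w1 s))
      (w s + (2 * gamma ^+ 2)^-1 *: (w1 s - w s)) @[s --> (0 : R)^'+] --> kap1.
    exact: (cvg_curried chic ehc whc).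
  rewrite /U1; clearbody yh kap1.
  refine (@implicit_stage_cvg _ E b (t + k) _ _ (fun eps => w eps
    + ((1 - gamma) / gamma) *: (w1 eps - w eps)) _ _ _ _ c0 _ _ _ _ xhc _ kapc _).
  - exact: bk0.
  - exact: Ekc.
  - exact: bkc.
  - exact: lkc.
  - apply: null; apply: cvgD; first exact: wW.
    by apply: cvgZl_tmp; apply: cvgB; [exact: w10|exact: wW].
  - by move=> eps eps0; have [] := w1P _ eps0.
have Exh := cvg_comp _ _ xhc (Ekc yh).
have s2 := cvg_dot Exh uU1.
split.
- apply: (@near_at_right_eq _ _ _ (fun eps => x eps
     + ((1 - gamma) * dt) *: (eps^-1 *: w1 eps) + (gamma * dt) *: (eps^-1 *: w' eps))).
    by move=> eps eps0; have [] := w1P _ eps0.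
  apply: cvgD; [apply: cvgD; first exact: xy|]; apply: cvgZl_tmp.
    exact: uU.
  exact: uU1.
- exact: small uU1.
- apply: (@near_at_right_eq _ _ _ (fun eps => e eps
     + (1 - gamma) * dt * dot (E t (x eps)) (eps^-1 *: w1 eps)
     + gamma * dt * dot (E (t + k) (x eps + k *: (eps^-1 *: w1 eps))) (eps^-1 *: w' eps))).
    by move=> eps eps0; have [] := w1P _ eps0.
  apply: cvgD; [apply: cvgD; first exact: eg|]; apply: cvgMl_tmp.
    exact: s1.
  exact: s2.
Qed.

End SchemeLimit.

(** * Smooth functions *)

Section Smooth.
Context {R : realType}.
Implicit Types V W : normedModType R.

Lemma smooth_differentiable V W (f : V -> W) x : smooth f -> differentiable f x.
Proof. by move=> /(_ 1%N) [+ _]; exact. Qed.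

Lemma smooth_continuous V W (f : V -> W) : smooth f -> continuous f.
Proof. by move=> /(_ 0%N). Qed.

Lemma smooth_derive V W (f : V -> W) v : smooth f -> smooth (fun x => 'D_v f x).
Proof. by move=> fs k; have [_] := fs k.+1; exact. Qed.

Lemma derive_linear_comp V W (U : normedModType R) (L : {linear W -> U})
    (f : V -> W) x v : continuous L -> differentiable f x ->
  'D_v (L \o f) x = L ('D_v f x).
Proof.
move=> Lc fd; have Ld y : differentiable L y by exact: linear_differentiable.
rewrite deriveE; last exact: differentiable_comp.
by rewrite diff_comp //= diff_lin // deriveE.
Qed.

Lemma smooth_linear_comp V W (U : normedModType R) (L : {linear W -> U})
    (f : V -> W) : continuous L -> smooth f -> smooth (L \o f).
Proof.
move=> Lc fs k; elim: k f fs => [|k IH] f fs.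
  by move=> x; apply: continuous_comp; [exact: smooth_continuous|exact: Lc].
split=> [x|v].
  apply: differentiable_comp; first exact: smooth_differentiable.
  exact: linear_differentiable.
rewrite (_ : (fun x => _) = L \o (fun x => 'D_v f x)).
  exact/IH/smooth_derive.
apply/funext => x; apply: derive_linear_comp => //.
exact: smooth_differentiable.
Qed.

(** A constant, rather than an anonymous function, so that it can carry a
    structure of linear map. *)
Definition coord (i : 'I_2) (u : 'rV[R]_2) : R := u 0 i.

Lemma coord_linear i : linear (coord i).
Proof. by move=> a u v; rewrite /coord !mxE. Qed.

HB.instance Definition _ i :=
  GRing.isLinear.Build R 'rV[R]_2 R _ (coord i) (coord_linear i).

Lemma coord_is_continuous i : continuous (coord i).
Proof. exact: coord_continuous. Qed.

Lemma smooth_coord V (f : V -> 'rV[R]_2) i :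
  smooth f -> smooth (fun x => f x 0 i).
Proof. by move=> fs; apply: (smooth_linear_comp (@coord_is_continuous i) fs). Qed.

Definition spatial (i : 'I_2) : R * 'rV[R]_2 := (0, delta_mx 0 i).

Lemma smooth_fst V W (U : normedModType R) (f : V -> W * U) :
  smooth f -> smooth (fun x => (f x).1).
Proof.
move=> fs; apply: (@smooth_linear_comp _ _ _ (@fst W U) f) => //.
by move=> x; exact: cvg_fst.
Qed.

Lemma smooth_snd V W (U : normedModType R) (f : V -> W * U) :
  smooth f -> smooth (fun x => (f x).2).
Proof.
move=> fs; apply: (@smooth_linear_comp _ _ _ (@snd W U) f) => //.
by move=> x; exact: cvg_snd.
Qed.

End Smooth.

(** * Symmetry of second derivatives *)

Section SecondDifferences.
Context {R : realType} {V : normedModType R}.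
Implicit Types (f : V -> R) (u v y a : V).

Lemma is_derive_line f u a (s : R) : differentiable f (s *: u + a) ->
  is_derive s 1 (fun r : R => f (r *: u + a)) ('D_u f (s *: u + a)).
Proof.
move=> fd.
have ld : is_diff s (fun r : R => r *: u + a) (fun r : R => r *: u).
  have := is_diffD (is_diff_scalel s u) (is_diff_cst a s).
  by rewrite addr0.
have [ldd ldE] := ld.
have cd : differentiable (f \o (fun r : R => r *: u + a)) s.
  by exact: differentiable_comp.
apply: DeriveDef; first exact: diff_derivable.
by rewrite (deriveE _ cd) diff_comp //= ldE scale1r deriveE.
Qed.

Lemma first_order (f : V -> R) y (e : R) : differentiable f y -> 0 < e ->
  exists2 d : R, 0 < d &
    forall k, `|k| < d -> `|f (k + y) - f y - 'd f y k| <= e * `|k|.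
Proof.
move=> fd e0.
have /eqaddoP/(_ e e0)/nbhs_ballP[d /= d0 dP] := diff_locally fd.
exists d => // k kd; have := dP k; rewrite -ball_normE /ball_ /= sub0r normrN.
by move=> /(_ kd); rewrite !fctE /= opprD addrA.
Qed.

(** The second difference equals h times an increment of the derivative of f
    along u, by the mean value theorem in the direction u; differentiability
    at y of that derivative then gives the estimate, the two remainders
    being taken at points within h N of y. *)
Lemma second_difference f u v y (e : R) :
  (forall z, differentiable f z) ->
  differentiable (fun z => 'D_u f z) y -> 0 < e ->
  \forall h \near (0 : R)^'+,
    `|f (h *: u + (h *: v + y)) - f (h *: u + y) - f (h *: v + y) + f y
       - h ^+ 2 * 'D_v (fun z => 'D_u f z) y| <= e * h ^+ 2.
Proof.
move=> fd gd e0; set g : V -> R := fun z => 'D_u f z.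
pose N := `|u| + `|v| + 1; have N0 : 0 < N by rewrite /N ltr_wpDl // addr_ge0.
have e'0 : 0 < e / (2 * N) by rewrite divr_gt0 // mulr_gt0.
have [d d0 dP] := first_order gd e'0.
near=> h; have h0 : 0 < h by near: h; exact: nbhs_right_gt.
have hd : h * N < d.
  rewrite -ltr_pdivlMr //; near: h; apply: nbhs_right_lt; exact: divr_gt0.
pose p (s : R) : R := f (s *: u + (h *: v + y)) - f (s *: u + y).
pose dp (s : R) : R := g (s *: u + (h *: v + y)) - g (s *: u + y).
have pd (s : R) : is_derive s 1 p (dp s).
  by apply: is_deriveB; apply: is_derive_line.
have [c cI] : exists2 c, c \in `]0, h[%R & p h - p 0 = dp c * (h - 0).
  apply: MVT => //; apply: continuous_subspaceT => s.
  by apply: differentiable_continuous; apply/derivable1_diffP; exact: ex_derive.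
rewrite subr0 => pE; move: cI; rewrite in_itv /= => /andP[c0 ch].
have cu : `|c *: u| <= h * `|u|.
  by rewrite normrZ gtr0_norm // ler_wpM2r // ltW.
have hv : `|h *: v| = h * `|v| by rewrite normrZ gtr0_norm.
have n1 : `|c *: u + h *: v| <= h * N.
  rewrite (le_trans (ler_normD _ _)) // hv (le_trans (lerD cu (lexx _))) //.
  by rewrite /N !mulrDr mulr1 lerDl ltW.
have n2 : `|c *: u| <= h * N.
  by rewrite (le_trans cu) // /N !mulrDr mulr1 -addrA lerDl addr_ge0 // ?mulr_ge0 // ltW.
have b1 := dP _ (le_lt_trans n1 hd); have b2 := dP _ (le_lt_trans n2 hd).
have dE : 'd g y (c *: u + h *: v) - 'd g y (c *: u) = h * 'D_v g y.
  by rewrite linearD addrAC subrr add0r linearZ deriveE.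
have -> : f (h *: u + (h *: v + y)) - f (h *: u + y) - f (h *: v + y) + f y = dp c * h.
  by rewrite -pE /p !scale0r !add0r; ring.
rewrite expr2 -mulrA -dE mulrC -mulrBr normrM gtr0_norm //.
rewrite (mulrC e) -mulrA ler_pM2l //.
rewrite /dp addrA -/g.
set A1 := g (_ + y) in b1 *; set A2 := g (c *: u + y) in b2 *.
set D1 := 'd g y (_ + _) in b1 *; set D2 := 'd g y (c *: u) in b2 *.
rewrite (_ : A1 - A2 - (D1 - D2) = (A1 - g y - D1) - (A2 - g y - D2)); last by ring.
apply: (le_trans (ler_normB _ _)); apply: (le_trans (lerD b1 b2)).
rewrite -mulrDr; apply: (@le_trans _ _ (e / (2 * N) * (2 * (h * N)))).
  by rewrite ler_pM2l // mulr_natl mulr2n lerD.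
by rewrite le_eqVlt; apply/orP; left; apply/eqP; field; rewrite gt_eqF.
Unshelve. all: by end_near. Qed.

Lemma at_right_common (P Q : R -> Prop) :
  (\forall h \near (0 : R)^'+, P h) -> (\forall h \near (0 : R)^'+, Q h) ->
  exists h : R, [/\ 0 < h, P h & Q h].
Proof.
move=> nP nQ; near (0 : R)^'+ => h; exists h; split.
- by near: h; exact: nbhs_right_gt.
- by near: h.
- by near: h.
Unshelve. all: by end_near. Qed.

(** Schwarz's theorem in the form that only asks the first derivatives to be
    differentiable at the point: the second difference is symmetric in u and
    v, and divided by h^2 it tends to both mixed derivatives. *)
Lemma derive_comm f u v y : (forall z, differentiable f z) ->
  differentiable (fun z => 'D_u f z) y -> differentiable (fun z => 'D_v f z) y ->
  'D_v (fun z => 'D_u f z) y = 'D_u (fun z => 'D_v f z) y.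
Proof.
move=> fd ud vd; apply/eqP; rewrite -subr_eq0 -normr_le0.
apply/ler_addgt0Pr => e e0; rewrite add0r.
have e20 : 0 < e / 2 by rewrite divr_gt0.
have [h [h0 hu hv]] : exists h : R, [/\ 0 < h,
    `|f (h *: u + (h *: v + y)) - f (h *: u + y) - f (h *: v + y) + f y
       - h ^+ 2 * 'D_v (fun z => 'D_u f z) y| <= e / 2 * h ^+ 2 &
    `|f (h *: v + (h *: u + y)) - f (h *: v + y) - f (h *: u + y) + f y
       - h ^+ 2 * 'D_u (fun z => 'D_v f z) y| <= e / 2 * h ^+ 2].
  have Huv := second_difference v fd ud e20.
  have Hvu := second_difference u fd vd e20.
  exact: at_right_common Huv Hvu.
have h20 : 0 < h ^+ 2 by rewrite exprn_gt0.
rewrite -(ler_pM2l h20) -{1}(gtr0_norm h20) -normrM.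
move: hu hv; rewrite (addrCA (h *: v) (h *: u)).
set Q := f (h *: u + _); set P1 := f (h *: u + y); set P2 := f (h *: v + y).
set X := 'D_v _ y; set Y := 'D_u _ y => hu hv.
rewrite (_ : h ^+ 2 * (X - Y) = (Q - P2 - P1 + f y - h ^+ 2 * Y) -
  (Q - P1 - P2 + f y - h ^+ 2 * X)); last by ring.
apply: (le_trans (ler_normB _ _)); apply: (le_trans (lerD hv hu)).
by rewrite -mulrDl -splitr mulrC.
Qed.

End SecondDifferences.

(** * Taylor estimates *)

Section Taylor.
Context {R : realType}.
Implicit Types (u f df v r : R -> R) (a h s M C : R).

(** Iterating this mean value inequality gives the Taylor bounds without the
    factors 1 / n!, since only their order in h matters. *)
Lemma growth_bound f df a h C n : 0 <= h -> 0 <= C ->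
  (forall s, a <= s <= a + h -> is_derive s 1 f (df s)) ->
  (forall s, a <= s <= a + h -> `|df s| <= C * (s - a) ^+ n) ->
  `|f (a + h) - f a| <= C * h ^+ n.+1.
Proof.
move=> h0 C0 fd dfC.
have aah : a <= a + h by rewrite lerDl.
have [c] : exists2 c, c \in `[a, a + h]%R & f (a + h) - f a = df c * (a + h - a).
  apply: (MVT_segment aah) => [s|].
    by rewrite in_itv /= => /andP[/ltW as_ /ltW sh]; apply: fd; rewrite as_.
  apply: derivable_within_continuous => s; rewrite in_itv /= => sI.
  exact: (@ex_derive _ _ _ _ _ _ _ (fd s sI)).
rewrite in_itv /= => cah ->; rewrite [a + h]addrC addrK normrM (ger0_norm h0).
rewrite exprSr mulrA ler_wpM2r // (le_trans (dfC c cah)) // ler_wpM2l //.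
by move/andP: cah => [ac ch]; rewrite lerXn2r ?nnegrE ?subr_ge0 // lerBlDl.
Qed.

Local Notation D u := (fun s => 'D_(1 : R) u s).

Lemma smooth_is_derive u s : smooth u -> is_derive s (1 : R) u ('D_1 u s).
Proof.
by move=> us; apply: derivableP; apply: diff_derivable; exact: smooth_differentiable.
Qed.

Lemma taylor0 u a h M : smooth u -> 0 <= h -> 0 <= M ->
  (forall s, a <= s <= a + h -> `|D u s| <= M) ->
  `|u (a + h) - u a| <= M * h.
Proof.
move=> us h0 M0 uM; rewrite -[h in leRHS]expr1.
apply: (@growth_bound u (D u) a h M 0 h0 M0) => [s _|s /uM].
  exact: smooth_is_derive.
by rewrite expr0 mulr1.
Qed.

Lemma taylor1 u a h M : smooth u -> 0 <= h -> 0 <= M ->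
  (forall s, a <= s <= a + h -> `|D (D u) s| <= M) ->
  `|u (a + h) - u a - h * D u a| <= M * h ^+ 2.
Proof.
move=> us h0 M0 uM.
rewrite (_ : _ - _ - _ = (u (a + h) - (a + h) * D u a) - (u a - a * D u a)); last by ring.
apply: (@growth_bound (fun s => u s - s * D u a) (fun s => D u s - D u a)) => //.
- move=> s _; have d1 := smooth_is_derive s us.
  have d2 := is_deriveM (is_derive_id s (1 : R)) (is_derive_cst (D u a) s 1).
  apply: (is_derive_eq (is_deriveB d1 d2)).
  by rewrite scaler0 add0r /GRing.scale /= mulr1.
- move=> s /andP[as_ sh]; rewrite expr1 -{1}(subrKC a s).
  apply: (@taylor0 (D u)) => //; first exact: smooth_derive.
    by rewrite subr_ge0.
  by move=> r; rewrite subrKC => /andP[ar rs]; apply: uM; rewrite ar (le_trans rs).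
Qed.

Lemma taylor2 u a h M : smooth u -> 0 <= h -> 0 <= M ->
  (forall s, a <= s <= a + h -> `|D (D (D u)) s| <= M) ->
  `|u (a + h) - u a - h * D u a - h ^+ 2 / 2 * D (D u) a| <= M * h ^+ 3.
Proof.
move=> us h0 M0 uM.
rewrite (_ : _ - _ - _ - _ =
  (u (a + h) - (a + h) * D u a - (a + h - a) ^+ 2 / 2 * D (D u) a)
   - (u a - a * D u a - (a - a) ^+ 2 / 2 * D (D u) a)); last by ring.
apply: (@growth_bound (fun s => u s - s * D u a - (s - a) ^+ 2 / 2 * D (D u) a)
   (fun s => D u s - D u a - (s - a) * D (D u) a)) => //.
- move=> s _; have d1 := smooth_is_derive s us.
  have d2 := is_deriveM (is_derive_id s (1 : R)) (is_derive_cst (D u a) s 1).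
  have d3 := is_deriveB (is_derive_id s (1 : R)) (is_derive_cst a s 1).
  have d4 := is_deriveM (is_deriveM d3 d3) (is_derive_cst (2^-1 * D (D u) a) s 1).
  have d5 := is_deriveB (is_deriveB d1 d2) d4.
  rewrite (_ : (fun s => _) = u - (id * cst (D u a)) -
     (id - cst a) * (id - cst a) * (cst (2^-1 * D (D u) a)))%R; last first.
    by apply/funext => q; rewrite !fctE /=; ring.
  apply: (is_derive_eq d5).
  by rewrite !fctE /GRing.scale /=; field.
- move=> s /andP[as_ sh].
  rewrite -{1}(subrKC a s).
  apply: (@taylor1 (D u)) => //; first exact: smooth_derive.
    by rewrite subr_ge0.
  by move=> r; rewrite subrKC => /andP[ar rs]; apply: uM; rewrite ar (le_trans rs).
Qed.

Lemma continuous_zero f a : {for a, continuous f} ->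
  (forall d, 0 < d -> exists2 s, `|s - a| < d & f s = 0) -> f a = 0.
Proof.
move=> fc fz; apply/eqP; rewrite -normr_le0; apply/ler_addgt0Pr => e e0.
rewrite add0r; have /cvgrPdist_lt/(_ e e0)/nbhs_ballP[d /= d0 dP] := fc.
have [s sa fs] := fz d d0.
have := dP s; rewrite -ball_normE /ball_ /= distrC => /(_ sa).
by rewrite fs subr0 => /ltW.
Qed.

End Taylor.

(** * Functions differentiable twice at a point *)

Section TwiceDifferentiable.
Context {R : realType}.
Implicit Types (u v f r : R -> R) (a c s : R).

(** Weaker than C^2: the first derivative exists near a and is differentiable at
    a. This is all that a quadratic bound at a needs, and it is stable under
    inversion where f does not vanish at a. *)
Definition derivable2 (f : R -> R) (a : R) : Prop :=
  exists2 v : R -> R,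
    \forall s \near a, is_derive s (1 : R) f (v s) & derivable v a (1 : R).

Lemma derivable2_near f a : derivable2 f a -> \forall s \near a, {for s, continuous f}.
Proof.
move=> [v fv _]; near=> s; have fs : is_derive s (1 : R) f (v s) by near: s.
apply: differentiable_continuous; apply/derivable1_diffP.
exact: (@ex_derive _ _ _ _ _ _ _ fs).
Unshelve. all: by end_near. Qed.

Lemma derivable2_derivable f a : derivable2 f a -> derivable f a (1 : R).
Proof.
move=> [v fv _]; have fa := nbhs_singleton fv.
exact: (@ex_derive _ _ _ _ _ _ _ fa).
Qed.

Lemma derivable2_continuous f a : derivable2 f a -> {for a, continuous f}.
Proof. by move=> /derivable2_near /nbhs_singleton. Qed.

Lemma derivable2_smooth f a : smooth f -> derivable2 f a.
Proof.
move=> fs; exists (fun s => 'D_(1 : R) f s).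
  by near=> s; exact: smooth_is_derive.
by apply: diff_derivable; apply: smooth_differentiable; exact: smooth_derive.
Unshelve. all: by end_near. Qed.

Lemma derivable2B f g a : derivable2 f a -> derivable2 g a -> derivable2 (f - g) a.
Proof.
move=> [v fv vd] [v' gv v'd]; exists (v - v'); last exact: derivableB.
near=> s; have fs : is_derive s (1 : R) f (v s) by near: s.
have gs : is_derive s (1 : R) g (v' s) by near: s.
exact: is_deriveB.
Unshelve. all: by end_near. Qed.

Lemma derivable2M f g a : derivable2 f a -> derivable2 g a -> derivable2 (f * g) a.
Proof.
move=> fd gd; have fa := derivable2_derivable fd; have ga := derivable2_derivable gd.
case: fd => v fv vd; case: gd => v' gv v'd.
exists (f * v' + g * v).
  2: exact: (derivableD (derivableM fa v'd) (derivableM ga vd)).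
near=> s; have fs : is_derive s (1 : R) f (v s) by near: s.
have gs : is_derive s (1 : R) g (v' s) by near: s.
exact: is_deriveM.
Unshelve. all: by end_near. Qed.

Lemma derivable2V f a : f a != 0 -> derivable2 f a ->
  derivable2 (fun s => (f s)^-1) a.
Proof.
move=> fa0 fd; have fa := derivable2_derivable fd.
have fc := derivable2_continuous fd; case: fd => v fv vd.
exists (fun s => - (f s) ^- 2 *: v s).
  have nz : \forall s \near a, f s != 0.
    have : \forall y \near f a, y != 0 by exact: (@open_neq R 0).
    by move/fc.
  near=> s; have fs : is_derive s (1 : R) f (v s) by near: s.
  have fs0 : f s != 0 by near: s.
  have fsd : derivable f s (1 : R) by exact: (@ex_derive _ _ _ _ _ _ _ fs).
  apply: DeriveDef; first exact: derivableV.
  by rewrite deriveV // (@derive_val _ _ _ _ _ _ _ fs).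
rewrite (_ : (fun s => _) = - ((fun s => (f s * f s)^-1) * v)); last first.
  by apply/funext => s; rewrite !fctE expr2 scaleNr.
have ff0 : (f * f) a != 0 by rewrite mulf_neq0.
exact: (derivableN (derivableM (derivableV ff0 (derivableM fa fa)) vd)).
Unshelve. all: by end_near. Qed.

(** By the chain rule the first derivative is a polynomial in the coordinates of
    Y' and the partial derivatives of F along the curve, which are all
    differentiable. *)
Lemma derivable2_comp (F : R * 'rV[R]_2 -> R) (Y : R -> 'rV[R]_2) a :
  smooth F -> smooth Y -> derivable2 (fun s => F (s, Y s)) a.
Proof.
move=> Fs Ys; pose c s : R * 'rV[R]_2 := (s, Y s).
have cd s : differentiable c s.
  by apply: differentiable_pair => //; exact: smooth_differentiable.
have Fc (H : R * 'rV[R]_2 -> R) s : smooth H -> derivable (H \o c) s (1 : R).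
  move=> Hs; apply: diff_derivable; apply: differentiable_comp => //.
  exact: smooth_differentiable.
have cE s : 'd c s (1 : R) = (1, 'D_(1 : R) Y s).
  have Yd := @smooth_differentiable _ _ _ Y s Ys.
  have idE : 'd (fun q : R => q) s = id :> (R -> R).
    exact: (@diff_val _ _ _ _ _ _ _ (is_diff_id s)).
  by rewrite /c diff_pair //= idE deriveE.
pose time : R * 'rV[R]_2 := (1, 0).
pose DF q : R -> R := (fun p => 'D_q F p) \o c.
pose DY i : R -> R := fun s => 'D_(1 : R) Y s 0 i.
exists (DF time + DY 0 * DF (spatial 0) + DY 1 * DF (spatial 1)).
  near=> s; apply: DeriveDef; first exact: (Fc F).
  rewrite !fctE /DF /DY /=.
  have Yd := @smooth_differentiable _ _ _ Y s Ys.
  have Fd := @smooth_differentiable _ _ _ F (c s) Fs.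
  have cd' := cd s.
  rewrite deriveE; last exact: differentiable_comp.
  rewrite (diff_comp cd' Fd) /= cE !deriveE //.
  have dZ (k : R) q : k * 'd F (c s) q = 'd F (c s) (k *: q) by rewrite linearZ.
  rewrite !dZ -!linearD.
  congr ('d F _ _); apply: injective_projections => /=; first by rewrite !scaler0 !addr0.
  by rewrite add0r -rV2_delta.
have DYd i : derivable (DY i) a (1 : R).
  apply: diff_derivable; apply: smooth_differentiable; apply: smooth_coord.
  exact: smooth_derive.
have DFd q : derivable (DF q) a (1 : R) by apply: Fc; exact: smooth_derive.
by apply: derivableD; [apply: derivableD => //|]; exact: derivableM.
Unshelve. all: by end_near. Qed.

Lemma continuous_zero_left f c a : c < a -> {for a, continuous f} ->
  (forall s, c < s < a -> f s = 0) -> f a = 0.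
Proof.
move=> ca fc f0; apply: continuous_zero fc _ => d d0.
set m := Num.max (a - d / 2) ((a + c) / 2).
have m1 : a - d / 2 <= m by rewrite le_max lexx.
have m2 : (a + c) / 2 <= m by rewrite le_max lexx orbT.
have m3 : m < a by rewrite gt_max; lra.
exists m; first by rewrite ltr_norml; lra.
by apply: f0; lra.
Qed.

(** By continuity r and its derivative vanish at a, so the derivative is O(s -
    a) there and the mean value inequality applies. *)
Lemma quadratic_vanishing r c a : c < a -> derivable2 r a ->
  (forall s, c < s < a -> r s = 0) ->
  exists C d : R, [/\ 0 <= C, 0 < d &
    forall h, 0 <= h < d -> `|r (a + h)| <= C * h ^+ 2].
Proof.
move=> ca rd r0.
have ra : r a = 0 by apply: (continuous_zero_left ca) => //; exact: derivable2_continuous.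
case: rd => v /nbhs_ballP[d /= d0 rv] vd.
have rvs s : `|s - a| < d -> is_derive s (1 : R) r (v s).
  by move=> sa; apply: rv; rewrite -ball_normE /ball_ /= distrC.
pose c' := Num.max c (a - d).
have c'a : c' < a by rewrite gt_max ca /= ltrBlDr ltrDl.
have vc : {for a, continuous v}.
  by apply: differentiable_continuous; exact/derivable1_diffP.
have v0 : v a = 0.
  apply: (continuous_zero_left c'a) => // s; rewrite gt_max => /andP[/andP[cs ds] sa].
  have sad : `|s - a| < d by rewrite ltr_norml; lra.
  have <- := @derive_val _ _ _ _ _ _ _ (rvs s sad).
  rewrite (@near_eq_derive _ _ _ r (cst 0) s 1) ?derive_cst //.
  have : s \in `]c, a[%R by rewrite in_itv /= cs sa.
  move=> /near_in_itvoo; apply: filterS => q; rewrite in_itv /= => qI.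
  by rewrite r0.
have [d2 d20 vE] := first_order (proj1 (derivable1_diffP _ _) vd) (@ltr01 R).
pose L := `|'D_(1 : R) v a|; pose dd := Num.min d d2.
exists (1 + L), dd; split; first by rewrite addr_ge0 // normr_ge0.
  by rewrite lt_min d0 d20.
move=> h /andP[h0]; rewrite lt_min => /andP[hd hd2].
rewrite -[r (a + h)]subr0 -ra.
apply: (@growth_bound _ r v a h (1 + L) 1) => // [|s /andP[as_ sh]|s /andP[as_ sh]].
- by rewrite addr_ge0 // normr_ge0.
- by apply: rvs; rewrite ger0_norm ?subr_ge0 //; lra.
have sa0 : 0 <= s - a by rewrite subr_ge0.
have := vE (s - a); rewrite subrK v0 subr0 mul1r.
rewrite [X in X < _]ger0_norm // => /(_ _)/wrap[]; first by lra.
have -> : 'd v a (s - a) = (s - a) * 'D_(1 : R) v a.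
  rewrite -[in LHS](mulr1 (s - a)) -[LHS]/('d v a ((s - a) *: (1 : R))).
  by rewrite linearZ /= deriveE //; exact/derivable1_diffP.
rewrite [X in _ <= X]ger0_norm // => vb; rewrite expr1 mulrDl mul1r.
rewrite -[v s](subrK ((s - a) * 'D_(1 : R) v a)) (le_trans (ler_normD _ _)) // lerD //.
by rewrite normrM ger0_norm // mulrC.
Qed.

End TwiceDifferentiable.

(** * Lipschitz bounds on compact boxes *)

Section BoundedLipschitz.
Context {R : realType} {T : Type} (close : T -> T -> R -> Prop).
Hypothesis close_ge0 : forall p q d, close p q d -> 0 <= d.
Implicit Types F G : T -> R.

(** The distance bound d is an argument of the relation close so that close can
    restrict the pairs of points, here to pairs with the same time
    coordinate in a box. Boundedness is included because products and
    inverses require it. *)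
Definition bounded_lipschitz F : Prop :=
  exists2 C : R, 0 <= C & forall p q d, close p q d ->
    [/\ `|F p| <= C, `|F q| <= C & `|F p - F q| <= C * d].

Lemma bounded_lipschitzB F G : bounded_lipschitz F -> bounded_lipschitz G ->
  bounded_lipschitz (fun p => F p - G p).
Proof.
move=> [C C0 FC] [C' C'0 GC]; exists (C + C'); first exact: addr_ge0.
move=> p q d pq; have [h1 h2 h3] := FC _ _ _ pq; have [k1 k2 k3] := GC _ _ _ pq.
split; [by rewrite (le_trans (ler_normB _ _)) // lerD
       |by rewrite (le_trans (ler_normB _ _)) // lerD|].
rewrite (_ : _ - _ - _ = (F p - F q) - (G p - G q)); last by ring.
by rewrite (le_trans (ler_normB _ _)) // mulrDl lerD.
Qed.

Lemma bounded_lipschitzM F G : bounded_lipschitz F -> bounded_lipschitz G ->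
  bounded_lipschitz (fun p => F p * G p).
Proof.
move=> [C C0 FC] [C' C'0 GC]; exists (2 * (C * C')).
  by rewrite !mulr_ge0.
have CC0 : 0 <= C * C' by exact: mulr_ge0.
move=> p q d pq; have [h1 h2 h3] := FC _ _ _ pq; have [k1 k2 k3] := GC _ _ _ pq.
have d0 := close_ge0 pq.
split.
- by rewrite normrM (le_trans (ler_pM _ _ h1 k1)) //; lra.
- by rewrite normrM (le_trans (ler_pM _ _ h2 k2)) //; lra.
rewrite (_ : _ - _ = F p * (G p - G q) + (F p - F q) * G q); last by ring.
rewrite (le_trans (ler_normD _ _)) // !normrM.
rewrite (_ : 2 * _ * d = C * (C' * d) + C * d * C'); last by ring.
by apply: lerD; apply: ler_pM.
Qed.

Lemma bounded_lipschitzV F (c : R) : 0 < c ->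
  (forall p q d, close p q d -> c <= F p /\ c <= F q) ->
  bounded_lipschitz F -> bounded_lipschitz (fun p => (F p)^-1).
Proof.
move=> c0 Fc [C C0 FC]; exists (c^-1 + C * (c^-1 * c^-1)).
  by rewrite addr_ge0 // ?mulr_ge0 // invr_ge0 ltW.
have ci : 0 < c^-1 by rewrite invr_gt0.
have C2 : 0 <= C * (c^-1 * c^-1) by rewrite !mulr_ge0 // ltW.
have inv x : c <= x -> `|x^-1| <= c^-1.
  move=> cx; have x0 := lt_le_trans c0 cx.
  by rewrite gtr0_norm ?invr_gt0 // lef_pV2.
move=> p q d pq; have [h1 h2 h3] := FC _ _ _ pq; have [k1 k2] := Fc _ _ _ pq.
have d0 := close_ge0 pq.
have Fp0 : F p != 0 by rewrite gt_eqF // (lt_le_trans c0).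
have Fq0 : F q != 0 by rewrite gt_eqF // (lt_le_trans c0).
split.
- by rewrite (le_trans (inv _ k1)) // lerDl.
- by rewrite (le_trans (inv _ k2)) // lerDl.
rewrite (_ : _ - _ = - (F p - F q) * ((F p)^-1 * (F q)^-1)); last first.
  by field; rewrite Fp0 Fq0.
rewrite !normrM normrN mulrDl (@le_trans _ _ (C * d * (c^-1 * c^-1))) //.
  by apply: ler_pM; rewrite ?mulr_ge0 //; apply: ler_pM; rewrite ?inv.
by rewrite mulrAC lerDr mulr_ge0 // ltW.
Qed.

End BoundedLipschitz.

Section SmoothLipschitz.
Context {R : realType}.
Implicit Types (t a c M g d : R) (y v : 'rV[R]_2).

Lemma continuous_box_bounded (F : R * 'rV[R]_2 -> R) a c M : continuous F ->
  exists2 C, 0 <= C & forall t y, a <= t <= c -> `|y| <= M -> `|F (t, y)| <= C.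
Proof.
move=> Fc; pose K := `[a, c]%classic `*` [set y : 'rV[R]_2 | `|y| <= M].
have Kc : compact K.
  apply: compact_setX; first exact: segment_compact.
  apply: bounded_closed_compact.
    exists M; split; first exact: num_real.
    by move=> N MN y /= yM; apply: le_trans yM (ltW MN).
  rewrite (_ : [set y | _] = (fun y : 'rV[R]_2 => `|y|) @^-1` [set r | r <= M]) //.
  apply: closed_comp; last exact: closed_le.
  by move=> y _; exact: norm_continuous.
have FKc : compact (F @` K).
  by apply: continuous_compact => //; exact: continuous_subspaceT.
have [N [_ NP]] := compact_bounded FKc.
exists (`|N| + 1); first by rewrite addr_ge0.
move=> t y tI yM; apply: NP.
  by rewrite (le_lt_trans (ler_norm N)) // ltrDl.
by exists (t, y) => //; split => //=; rewrite in_itv.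
Qed.

Definition box_close a c M (p q : R * 'rV[R]_2 * R) d : Prop :=
  [/\ a <= p.1.1 <= c, p.1.1 = q.1.1, `|p.1.2| <= M /\ `|q.1.2| <= M,
      `|p.2| <= M /\ `|q.2| <= M & `|p.1.2 - q.1.2| <= d /\ `|p.2 - q.2| <= d].

Lemma box_close_ge0 a c M p q d : box_close a c M p q d -> 0 <= d.
Proof. by move=> [_ _ _ _ [_]]; exact: le_trans. Qed.

Lemma bounded_lipschitz_last a c M : 0 <= M ->
  bounded_lipschitz (box_close a c M) (fun p => p.2).
Proof.
move=> M0; exists (M + 1); first by rewrite addr_ge0.
move=> p q d pq; have d0 := box_close_ge0 pq; case: pq => _ _ _ [h1 h2] [_ h3].
split; [by rewrite (le_trans h1) // lerDl|by rewrite (le_trans h2) // lerDl|].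
by rewrite mulrDl mul1r (le_trans h3) // lerDr mulr_ge0.
Qed.

(** The mean value inequality is applied on the segment between the two
    positions, which stays in the box by convexity; the derivative along it
    is controlled by the two spatial partial derivatives. *)
Lemma bounded_lipschitz_smooth (F : R * 'rV[R]_2 -> R) a c M : smooth F ->
  bounded_lipschitz (box_close a c M) (fun p => F p.1).
Proof.
move=> Fs.
have [C C0 FC] := continuous_box_bounded a c M (smooth_continuous Fs).
have DF i := smooth_continuous (smooth_derive (spatial i : R * 'rV[R]_2) Fs).
have [C1 C10 FC1] := continuous_box_bounded a c M (DF 0).
have [C2 C20 FC2] := continuous_box_bounded a c M (DF 1).
exists (C + (C1 + C2)); first by rewrite !addr_ge0.
move=> p q d pq; have d0 := box_close_ge0 pq.
case: p q pq => [[t y] g] [[t' y'] g'] [/= tI <- [yM y'M] _ [yd _]].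
split; [by rewrite (le_trans (FC _ _ _ _)) // lerDl addr_ge0
       |by rewrite (le_trans (FC _ _ _ _)) // lerDl addr_ge0|].
pose u (s : R) := F (s *: (0, y - y') + (t, y')).
pose du (s : R) : R := 'D_((0, y - y') : R * 'rV[R]_2) F (s *: (0, y - y') + (t, y')).
have uE : F (t, y) - F (t, y') = u (0 + 1) - u 0.
  rewrite /u add0r scale0r scale1r add0r; congr (F _ - _).
  by apply: injective_projections; rewrite /= ?add0r ?subrK.
rewrite uE; apply: (@le_trans _ _ ((C1 + C2) * d * 1 ^+ 1)); last first.
  by rewrite expr1 mulr1 [leRHS]mulrDl lerDr mulr_ge0.
apply: (@growth_bound _ u du 0 1 ((C1 + C2) * d) 0) => //.
- by rewrite mulr_ge0 // addr_ge0.
- move=> s _; apply: (@is_derive_line _ _ F); exact: smooth_differentiable.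
move=> s; rewrite add0r => /andP[s0 s1]; rewrite expr0 mulr1 /du.
have -> : s *: ((0, y - y') : R * 'rV[R]_2) + (t, y') = (t, s *: y + (1 - s) *: y').
  apply: injective_projections; rewrite /= ?scaler0 ?add0r //.
  by rewrite scalerBr scalerBl scale1r -addrA; congr (_ + _); rewrite addrC.
set z := s *: y + (1 - s) *: y'.
have zM : `|z| <= M.
  have s1' : 0 <= 1 - s by rewrite subr_ge0.
  rewrite (le_trans (ler_normD _ _)) // !normrZ !ger0_norm //.
  rewrite (@le_trans _ _ (s * M + (1 - s) * M)) //; last by lra.
  by rewrite lerD // ler_wpM2l.
have -> : 'D_((0, y - y') : R * 'rV[R]_2) F (t, z) =
    (y - y') 0 0 * 'D_(spatial 0) F (t, z) + (y - y') 0 1 * 'D_(spatial 1) F (t, z).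
  have Fd := @smooth_differentiable _ _ _ F (t, z) Fs.
  have dZ (k : R) q : k * 'd F (t, z) q = 'd F (t, z) (k *: q) by rewrite linearZ.
  rewrite !deriveE // !dZ -linearD; congr ('d F _ _).
  apply: injective_projections; rewrite /= ?scaler0 ?addr0 //.
  by rewrite -rV2_delta.
apply: (le_trans (ler_normD _ _)); rewrite !normrM mulrDl.
have yi i : `|(y - y') 0 i| <= d by exact: le_trans (coord_le_norm _ _) yd.
by rewrite [X in _ <= X]addrC [C1 * d]mulrC [C2 * d]mulrC [X in _ <= X]addrC;
  apply: lerD; apply: ler_pM => //; [exact: FC1|exact: FC2].
Qed.

End SmoothLipschitz.

(** * Order two for the two-stage method *)

Section TwoStageConsistency.
Context {R : realType}.
Implicit Types (t a c M g d h s : R).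

Lemma segment_bounded (W : normedModType R) (f : R -> W) a c : continuous f ->
  exists2 C, 0 <= C & forall s, a <= s <= c -> `|f s| <= C.
Proof.
move=> fc; have fKc : compact (f @` `[a, c]%classic).
  by apply: continuous_compact; [exact: continuous_subspaceT|exact: segment_compact].
have [N [_ NP]] := compact_bounded fKc.
exists (`|N| + 1); first by rewrite addr_ge0.
move=> s sI; apply: NP; first by rewrite (le_lt_trans (ler_norm N)) // ltrDl.
by exists s => //=; rewrite in_itv.
Qed.

Lemma derive_coord (V : normedModType R) (Y : V -> 'rV[R]_2) (x v : V) i : smooth Y ->
  'D_v (fun z => Y z 0 i) x = ('D_v Y x) 0 i.
Proof.
move=> Ys; apply: (derive_linear_comp v (@coord_is_continuous R i)).
exact: smooth_differentiable.
Qed.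

Lemma taylor1_rV2 (Y : R -> 'rV[R]_2) a h M : smooth Y -> 0 <= h -> 0 <= M ->
  (forall s, a <= s <= a + h -> `|'D_(1 : R) (fun r => 'D_(1 : R) Y r) s| <= M) ->
  `|Y (a + h) - (Y a + h *: 'D_(1 : R) Y a)| <= M * h ^+ 2.
Proof.
move=> Ys h0 M0 YM.
have Y's := smooth_derive (1 : R) Ys.
have comp i : `|(Y (a + h) - (Y a + h *: 'D_(1 : R) Y a)) 0 i| <= M * h ^+ 2.
  have := @taylor1 _ (fun s => Y s 0 i) a h M (smooth_coord i Ys) h0 M0.
  rewrite derive_coord // !mxE opprD addrA; apply => s sI.
  rewrite (_ : (fun r => _) = (fun r => 'D_(1 : R) Y r 0 i)); last first.
    by apply/funext => r; rewrite derive_coord.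
  rewrite (@derive_coord _ (fun r => 'D_(1 : R) Y r)) //.
  exact: le_trans (coord_le_norm _ _) (YM s sI).
exact: norm_rV2_le.
Qed.

(** One component of the two-stage method: u is that component of the solution,
    Y and G are the position and energy that Psi depends on, and gam * kap =
    1/2 is the condition for order two. The error is split into four parts:
    the predictor against the solution at t + kap h (Lipschitz bound), the
    defect of the solution at that time (zero before t1, quadratic after),
    and the Taylor remainders of u' and of u. *)
Lemma two_stage_consistent (gam kap t0 t1 : R) (Psi : R * 'rV[R]_2 * R -> R)
    (u G : R -> R) (Y : R -> 'rV[R]_2) :
  0 < gam -> 0 < kap -> gam * kap = 2^-1 -> t0 < t1 ->
  smooth u -> smooth G -> smooth Y ->
  (forall M, 0 <= M -> bounded_lipschitz (box_close t0 (t1 + 1) M) Psi) ->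
  (forall s, t0 <= s <= t1 -> 'D_1 u s = Psi (s, Y s, G s)) ->
  derivable2 (fun s => 'D_1 u s - Psi (s, Y s, G s)) t1 ->
  exists C d : R, [/\ 0 <= C, 0 < d & forall h t, 0 < h < d -> t0 <= t -> t + h <= t1 ->
    `|u t + (1 - gam) * h * 'D_1 u t
       + gam * h * Psi (t + kap * h, Y t + (kap * h) *: 'D_1 Y t, G t + kap * h * 'D_1 G t)
       - u (t + h)| <= C * h ^+ 3].
Proof.
move=> gam0 kap0 gk t01 us Gs Ys lip solves r2.
have u's := smooth_derive (1 : R) us; have u''s := smooth_derive (1 : R) u's.
have u'''s := smooth_derive (1 : R) u''s.
have Y's := smooth_derive (1 : R) Ys; have Y''s := smooth_derive (1 : R) Y's.
have G's := smooth_derive (1 : R) Gs; have G''s := smooth_derive (1 : R) G's.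
pose bnd (W : normedModType R) (f : R -> W) (fs : smooth f) :=
  segment_bounded t0 (t1 + 1) (smooth_continuous fs).
have [Y0 Y00 Y0P] := bnd _ _ Ys; have [Y1 Y10 Y1P] := bnd _ _ Y's.
have [Y2 Y20 Y2P] := bnd _ _ Y''s.
have [G0 G00 G0P] := bnd _ _ Gs; have [G1 G10 G1P] := bnd _ _ G's.
have [G2 G20 G2P] := bnd _ _ G''s.
have [U2 U20 U2P] := bnd _ _ u'''s.
pose M := Y0 + Y1 + (G0 + G1); have M0 : 0 <= M by rewrite !addr_ge0.
have [L L0 LP] := lip M M0.
have [Q [dq [Q0 dq0 QP]]] : exists C d, [/\ 0 <= C, 0 < d & forall h, 0 <= h < d ->
    `|'D_1 u (t1 + h) - Psi (t1 + h, Y (t1 + h), G (t1 + h))| <= C * h ^+ 2].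
  apply: (quadratic_vanishing t01 r2) => s /andP[s0 s1].
  by rewrite solves ?subrr // !ltW.
pose A := Y2 + G2; have A0 : 0 <= A by rewrite addr_ge0.
(* The radius keeps t + kap h inside [t0, t1 + 1], where the bounds hold, and
   within dq of t1 when it exceeds t1. *)
exists (gam * kap ^+ 2 * (L * A + Q + U2) + U2), (Num.min 1 (Num.min 1 dq / kap)).
split.
- by rewrite addr_ge0 // !mulr_ge0 ?addr_ge0 ?mulr_ge0 // ?exprn_ge0 // ltW.
- by rewrite lt_min ltr01 divr_gt0 // lt_min ltr01.
move=> h t /andP[h0]; rewrite lt_min ltr_pdivlMr // lt_min (mulrC h).
set k := kap * h => /andP[h1 /andP[k1 kdq]] tt0 tht1.
have k0 : 0 < k by rewrite mulr_gt0.
have tI : t0 <= t <= t1 + 1 by rewrite tt0 /=; lra.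
have tt1 : t <= t1 by rewrite (le_trans _ tht1) // lerDl ltW.
have tk_le : t + k <= t1 + 1 by rewrite lerD // ltW.
have sub s : t <= s <= t + k -> t0 <= s <= t1 + 1.
  by case/andP=> ts st; rewrite (le_trans tt0 ts) (le_trans st).
have tkI : t0 <= t + k <= t1 + 1 by rewrite sub // lexx lerDl ltW.
have subh s : t <= s <= t + h -> t0 <= s <= t1 + 1.
  by case/andP=> ts st; rewrite (le_trans tt0 ts) (le_trans st) // (le_trans tht1) // lerDl.
pose p := (t + k, Y t + k *: 'D_1 Y t, G t + k * 'D_1 G t).
pose q := (t + k, Y (t + k), G (t + k)).
have pq : box_close t0 (t1 + 1) M p q (A * k ^+ 2).
  have k20 : 0 <= k ^+ 2 by rewrite exprn_ge0 // ltW.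
  split => //=; split.
  - rewrite (le_trans (ler_normD _ _)) // normrZ gtr0_norm //.
    rewrite /M -[leLHS]addr0 lerD ?addr_ge0 // lerD ?Y0P //.
    by rewrite -[leRHS]mul1r ler_pM ?Y1P // ltW.
  - by rewrite (le_trans (Y0P _ tkI)) // /M -!addrA lerDl !addr_ge0.
  - rewrite (le_trans (ler_normD _ _)) // normrM gtr0_norm //.
    rewrite /M -[leLHS]add0r lerD ?addr_ge0 // lerD ?G0P //.
    by rewrite -[leRHS]mul1r ler_pM ?G1P // ltW.
  - by rewrite (le_trans (G0P _ tkI)) // /M addrCA lerDl !addr_ge0.
  - rewrite distrC (le_trans (@taylor1_rV2 Y t k Y2 Ys (ltW k0) Y20 _)) //.
    + by move=> s /sub; exact: Y2P.
    + by rewrite /A mulrDl lerDl mulr_ge0.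
  - rewrite distrC opprD addrA (le_trans (@taylor1 _ G t k G2 Gs (ltW k0) G20 _)) //.
    + by move=> s /sub; exact: G2P.
    + by rewrite /A mulrDl lerDr mulr_ge0.
have e1 : `|Psi p - Psi q| <= L * (A * k ^+ 2) by have [] := LP _ _ _ pq.
have e2 : `|Psi q - 'D_1 u (t + k)| <= Q * k ^+ 2.
  have [tk1|tk1] := leP (t + k) t1.
    have tkI1 : t0 <= t + k <= t1 by case/andP: tkI => ->.
    by rewrite solves // subrr normr0 mulr_ge0 // exprn_ge0 // ltW.
  have := QP (t + k - t1); rewrite subrKC distrC => H.
  have h'0 : 0 <= t + k - t1 by rewrite subr_ge0 ltW.
  have h'k : t + k - t1 <= k by rewrite lerBlDr addrC lerD2l.
  apply: (le_trans (H _)); first by rewrite h'0 (le_lt_trans h'k).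
  by apply: ler_wpM2l => //; apply: lerXn2r; rewrite ?nnegrE // ltW.
have e3 : `|'D_1 u (t + k) - 'D_1 u t - k * 'D_1 (fun s => 'D_1 u s) t| <= U2 * k ^+ 2.
  apply: (@taylor1 _ (fun s => 'D_1 u s)) => //; first exact: ltW.
  by move=> s /sub; exact: U2P.
have e4 : `|u (t + h) - u t - h * 'D_1 u t - h ^+ 2 / 2 * 'D_1 (fun s => 'D_1 u s) t|
    <= U2 * h ^+ 3.
  by apply: taylor2 => //; [exact: ltW|move=> s /subh; exact: U2P].
move: e1 e2 e3 e4; rewrite -/p.
set P1 := Psi p; set P2 := Psi q; set D1 := 'D_1 u (t + k); set D0 := 'D_1 u t.
set DD := 'D_1 _ t; set u1 := u (t + h) => e1 e2 e3 e4.
rewrite (_ : u t + _ + _ - _ = gam * h * ((P1 - P2) + (P2 - D1) + (D1 - D0 - k * DD))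
  - (u1 - u t - h * D0 - h ^+ 2 / 2 * DD)); last first.
  (* The order-two condition cancels the terms in u''. *)
  rewrite (_ : h ^+ 2 / 2 = h ^+ 2 * (gam * kap)); last by rewrite gk.
  by rewrite /k; ring.
rewrite (le_trans (ler_normB _ _)) // [leRHS]mulrDl lerD //.
rewrite normrM (gtr0_norm (mulr_gt0 gam0 h0)).
rewrite (_ : gam * kap ^+ 2 * _ * _ =
    gam * h * (L * (A * k ^+ 2) + Q * k ^+ 2 + U2 * k ^+ 2)); last first.
  by rewrite /k; ring.
rewrite ler_wpM2l //; first by rewrite mulr_ge0 // ltW.
by rewrite (le_trans (ler_normD _ _)) // lerD // (le_trans (ler_normD _ _)) // lerD.
Qed.

End TwoStageConsistency.

(** * The fields, the limit scheme and its consistency *)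

Section Fields.
Context {R : realType}.
Context (E : R -> 'rV[R]_2 -> 'rV[R]_2) (b : R -> 'rV[R]_2 -> R) (b0 : R).
Context (Ex : R * 'rV[R]_2 -> 'rV[R]_2) (Bx : R * 'rV[R]_2 -> R).
Hypothesis Ex_smooth : smooth Ex.
Hypothesis Bx_smooth : smooth Bx.
Hypothesis ExE : forall p, [set p | 0 <= p.1] p -> E p.1 p.2 = Ex p.
Hypothesis BxE : forall p, [set p | 0 <= p.1] p -> b p.1 p.2 = Bx p.
Hypothesis b0_gt0 : 0 < b0.
Hypothesis b_ge : forall t x, 0 <= t -> b0 <= b t x.
Implicit Types (t g : R) (y v : 'rV[R]_2).

(** Pointwise in t >= 0 the fields coincide with smooth extensions, so their
    slices are equal as functions of position and have the same spatial
    derivatives, also at t = 0. *)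
Lemma slice_E t : 0 <= t -> E t = fun y => Ex (t, y).
Proof. by move=> t0; apply/funext => y; rewrite -ExE. Qed.

Lemma slice_b t : 0 <= t -> b t = fun y => Bx (t, y).
Proof. by move=> t0; apply/funext => y; rewrite -BxE. Qed.

Lemma b_gt0 t y : 0 <= t -> 0 < b t y.
Proof. by move=> t0; apply: lt_le_trans (b_ge _ t0). Qed.

Lemma b_neq0 t y : 0 <= t -> b t y != 0.
Proof. by move=> t0; rewrite gt_eqF // b_gt0. Qed.

Lemma slice_continuous (W : normedModType R) (F : R * 'rV[R]_2 -> W) t :
  smooth F -> continuous (fun y => F (t, y)).
Proof.
move=> Fs y; apply: differentiable_continuous; apply: differentiable_slice.
exact: smooth_differentiable.
Qed.

Lemma E_continuous t : 0 <= t -> continuous (E t).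
Proof. by move=> t0; rewrite slice_E //; exact: slice_continuous. Qed.

Lemma b_continuous t : 0 <= t -> continuous (b t).
Proof. by move=> t0; rewrite slice_b //; exact: slice_continuous. Qed.

Lemma b_differentiable t y : 0 <= t -> differentiable (b t) y.
Proof.
by move=> t0; rewrite slice_b //; apply: differentiable_slice; exact: smooth_differentiable.
Qed.

Lemma E_coord_differentiable t y i : 0 <= t ->
  differentiable (fun x => E t x 0 i) y.
Proof.
move=> t0; rewrite slice_E //.
apply: (@differentiable_slice _ _ (fun p => Ex p 0 i)).
by apply: smooth_differentiable; exact: smooth_coord.
Qed.

Lemma grad_bE t y i : 0 <= t -> grad (b t) y 0 i = 'D_(spatial i) Bx (t, y).
Proof. by move=> t0; rewrite slice_b // mxE derive_slice. Qed.

Lemma grad_ln_bE t y : 0 <= t ->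
  grad_ln_b b t y = (b t y)^-1 *: grad (b t) y.
Proof.
move=> t0; apply/rowP => i; rewrite !mxE.
have D := is_derive_ln (delta_mx 0 i) (b_differentiable y t0) (b_gt0 y t0).
exact: (@derive_val _ _ _ _ _ _ _ D).
Qed.

Lemma grad_ln_b_continuous t : 0 <= t -> continuous (grad_ln_b b t).
Proof.
move=> t0 y; rewrite (_ : grad_ln_b b t = fun y => (b t y)^-1 *: grad (b t) y).
  have bc : {for y, continuous (fun z => (b t z)^-1)}.
    by apply: continuousV; [exact: b_neq0|exact: b_continuous].
  have gc i : (grad (b t) z 0 i @[z --> y] --> grad (b t) y 0 i).
    rewrite grad_bE //; under eq_fun do rewrite grad_bE //.
    by apply: (@slice_continuous _ (fun p => 'D_(spatial i) Bx p)); exact: smooth_derive.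
  by apply: (continuousZ bc); exact: (@cvg_rV2 _ _ (nbhs y) _ (grad (b t)) _ (gc 0) (gc 1)).
by apply/funext => z; exact: grad_ln_bE.
Qed.

(** The right-hand side of the limit system as rational expressions in E_1, E_2,
    b, its two spatial derivatives and g. *)
Definition rateU0 (e0 e1 c c0 c1 g : R) := (e1 - g * (c1 / c)) / c.
Definition rateU1 (e0 e1 c c0 c1 g : R) := - (e0 - g * (c0 / c)) / c.
Definition rateT (e0 e1 c c0 c1 g : R) := g * (c0 * e1 - c1 * e0) / (c * c).

(** Written with the extensions of the fields, so that it makes sense as a
    function on the whole of space-time; the extension of b can vanish at
    negative times. *)
Definition on_fields (f : R -> R -> R -> R -> R -> R -> R) (p : R * 'rV[R]_2) g :=
  f (Ex p 0 0) (Ex p 0 1) (Bx p) ('D_(spatial 0) Bx p) ('D_(spatial 1) Bx p) g.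

Lemma limit_U0E t y g : 0 <= t -> limit_U E b t y g 0 0 = on_fields rateU0 (t, y) g.
Proof.
move=> t0; have bn := b_neq0 y t0.
rewrite /on_fields /rateU0 -!grad_bE // -ExE //= -BxE //= /limit_U grad_ln_bE //.
by set G := grad _ _; rewrite !mxE /= ; field.
Qed.

Lemma limit_U1E t y g : 0 <= t -> limit_U E b t y g 0 1 = on_fields rateU1 (t, y) g.
Proof.
move=> t0; have bn := b_neq0 y t0.
rewrite /on_fields /rateU1 -!grad_bE // -ExE //= -BxE //= /limit_U grad_ln_bE //.
by set G := grad _ _; rewrite !mxE /= ; field.
Qed.

Lemma limit_TE t y g : 0 <= t -> limit_T E b t y g = on_fields rateT (t, y) g.
Proof.
move=> t0; have bn := b_neq0 y t0.
rewrite /on_fields /rateT -!grad_bE // -ExE //= -BxE //= /limit_T dotE /perp_grad.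
by set G := grad _ _; rewrite !mxE /= ; field.
Qed.

(** The electric drift is orthogonal to E; only the drift due to the gradient of
    b works. *)
Lemma dot_limit_U t y g : 0 <= t -> dot (E t y) (limit_U E b t y g) = limit_T E b t y g.
Proof.
move=> t0; have bn := b_neq0 y t0.
rewrite limit_TE // dotE limit_U0E // limit_U1E //.
rewrite /on_fields /rateT /rateU0 /rateU1 -ExE //= -BxE //= -!grad_bE //.
by field.
Qed.

Section Convergence.
Context (chi : R -> 'rV[R]_2 -> R).
Hypothesis chi_cont : continuous (fun p : R * 'rV[R]_2 => chi p.1 p.2).
Hypothesis chi_lim : forall e : R, chi e w @[w --> (0 : 'rV[R]_2)^'] --> e.
Context (dt : R) (N : nat) (x w : R -> nat -> 'rV[R]_2) (e : R -> nat -> R).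
Hypothesis dt_gt0 : 0 < dt.
Hypothesis scheme : forall (eps : R) (n : nat), 0 < eps -> (n < N)%N ->
  scheme_step E b chi eps dt (n%:R * dt)
    (x eps n) (w eps n) (e eps n) (x eps n.+1) (w eps n.+1) (e eps n.+1).

(** When the incoming velocity tends to 0, chi is evaluated at rest in the limit
    and returns the limit energy, which gives the limit scheme; at the step
    from time 0 the velocity only tends to w0. *)
Lemma scheme_advance n (y W : 'rV[R]_2) (g : R) : (n < N)%N ->
  x eps n @[eps --> 0^'+] --> y -> w eps n @[eps --> 0^'+] --> W ->
  e eps n @[eps --> 0^'+] --> g ->
  exists (y' : 'rV[R]_2) (g' : R),
  [/\ x eps n.+1 @[eps --> 0^'+] --> y',
      w eps n.+1 @[eps --> 0^'+] --> (0 : 'rV[R]_2),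
      e eps n.+1 @[eps --> 0^'+] --> g' &
      W = 0 -> (y', g') = limit_step E b dt (n%:R * dt) (y, g)].
Proof.
move=> nN xy wW eg; set t := n%:R * dt.
have t0 : 0 <= t by rewrite mulr_ge0 // ltW.
have tk0 : 0 <= t + dt / (2 * gamma).
  by rewrite addr_ge0 // divr_ge0 // ?mulr_ge0 // ltW // gamma_gt0.
have [x'l w'l e'l] := scheme_step_cvg dt_gt0 (fun z => b_neq0 z t0) (fun z => b_neq0 z tk0)
  (E_continuous t0) (b_continuous t0) (grad_ln_b_continuous t0)
  (E_continuous tk0) (b_continuous tk0) (grad_ln_b_continuous tk0) chi_cont
  (fun eps eps0 => scheme eps0 nN) xy wW eg.
do 2 eexists; split; [exact: x'l|exact: w'l|exact: e'l|] => W0.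
have chi0 (k : R) : chi k 0 = k by exact: (chi_at_rest chi_cont (@chi_lim k)).
rewrite W0 subrr scaler0 addr0 !chi0.
by rewrite !dot_limit_U.
Qed.

(** The velocity is part of the induction: it has a limit w0 at step 0, and
    tends to 0 at all later steps. *)
Lemma scheme_cvg (y0 w0 : 'rV[R]_2) (g0 : R) :
  x eps 0%N @[eps --> 0^'+] --> y0 -> w eps 0%N @[eps --> 0^'+] --> w0 ->
  e eps 0%N @[eps --> 0^'+] --> g0 ->
  exists (y : nat -> 'rV[R]_2) (g : nat -> R),
     (forall n : nat, (1 <= n <= N)%N ->
        x eps n @[eps --> 0^'+] --> y n /\ e eps n @[eps --> 0^'+] --> g n) /\
     (forall n : nat, (1 <= n)%N -> (n <= N - 1)%N ->
        (y n.+1, g n.+1) = limit_step E b dt (n%:R * dt) (y n, g n)).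
Proof.
move=> x0 w0' e0.
have H n : (n <= N)%N -> exists (y W : 'rV[R]_2) (g : R),
    [/\ x eps n @[eps --> 0^'+] --> y, w eps n @[eps --> 0^'+] --> W,
        e eps n @[eps --> 0^'+] --> g & (0 < n)%N -> W = 0].
  elim: n => [_|n IH nN]; first by exists y0, w0, g0.
  have [y [W [g [xy wW eg _]]]] := IH (ltnW nN).
  have [y' [g' [x'l w'l e'l _]]] := scheme_advance nN xy wW eg.
  by exists y', 0, g'.
pose y n : 'rV[R]_2 := lim (x eps n @[eps --> (0 : R)^'+]).
pose g n : R := lim (e eps n @[eps --> (0 : R)^'+]).
have cv n : (n <= N)%N -> [/\ x eps n @[eps --> 0^'+] --> y n,
    e eps n @[eps --> 0^'+] --> g n &
    (0 < n)%N -> w eps n @[eps --> 0^'+] --> (0 : 'rV[R]_2)].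
  move=> /H [y' [W [g' [xy wW eg W0]]]].
  rewrite /y /g (cvg_lim _ xy) // (cvg_lim _ eg) //; split => // n0.
  by rewrite -(W0 n0).
exists y, g; split=> [n /andP[_ nN]|n n1 nN]; first by have [] := cv n nN.
have nltN : (n < N)%N by lia.
have [xy eg /(_ n1) wW] := cv n (ltnW nltN).
have [y' [g' [x'l _ e'l /(_ erefl) <-]]] := scheme_advance nltN xy wW eg.
by rewrite /y /g (cvg_lim _ x'l) // (cvg_lim _ e'l).
Qed.

End Convergence.

(** An abstract form of: f is built from subtraction, multiplication and the
    inverse of its third argument. Both the Lipschitz bounds and the
    differentiability of f on the fields follow by instantiating K. *)
Definition rational_rate (f : R -> R -> R -> R -> R -> R -> R) : Prop :=
  forall (T : Type) (K : (T -> R) -> Prop) (e0 e1 c c0 c1 g : T -> R),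
  (forall f1 f2, K f1 -> K f2 -> K (fun p => f1 p - f2 p)) ->
  (forall f1 f2, K f1 -> K f2 -> K (fun p => f1 p * f2 p)) ->
  K e0 -> K e1 -> K (fun p => (c p)^-1) -> K c0 -> K c1 -> K g ->
  K (fun p => f (e0 p) (e1 p) (c p) (c0 p) (c1 p) (g p)).

Lemma rational_rateU0 : rational_rate rateU0.
Proof.
move=> T K e0 e1 c c0 c1 g KB KM Ke0 Ke1 Kc Kc0 Kc1 Kg.
by apply: (KM) => //; apply: (KB) => //; apply: (KM) => //; exact: (KM).
Qed.

Lemma rational_rateU1 : rational_rate rateU1.
Proof.
move=> T K e0 e1 c c0 c1 g KB KM Ke0 Ke1 Kc Kc0 Kc1 Kg.
rewrite (_ : (fun p => _) = fun p => (g p * (c0 p / c p) - e0 p) / c p).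
  by apply: (KM) => //; apply: (KB) => //; apply: (KM) => //; exact: (KM).
by apply/funext => p; rewrite /rateU1 opprB.
Qed.

Lemma rational_rateT : rational_rate rateT.
Proof.
move=> T K e0 e1 c c0 c1 g KB KM Ke0 Ke1 Kc Kc0 Kc1 Kg.
rewrite (_ : (fun p => _) =
    fun p => g p * (c0 p * e1 p - c1 p * e0 p) * ((c p)^-1 * (c p)^-1)).
  by apply: (KM) => //; apply: (KM) => //; apply: (KB) => //; exact: (KM).
by apply/funext => p; rewrite /rateT invfM.
Qed.

Lemma on_fields_lipschitz f a c M : rational_rate f -> 0 <= a -> 0 <= M ->
  bounded_lipschitz (box_close a c M) (fun p => on_fields f p.1 p.2).
Proof.
move=> fr a0 M0; have d0 := @box_close_ge0 _ a c M.
apply: fr.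
- by move=> f1 f2; exact: bounded_lipschitzB.
- by move=> f1 f2; exact: bounded_lipschitzM.
- exact: (bounded_lipschitz_smooth _ _ _ (smooth_coord 0 Ex_smooth)).
- exact: (bounded_lipschitz_smooth _ _ _ (smooth_coord 1 Ex_smooth)).
- apply: (bounded_lipschitzV d0 b0_gt0).
    move=> [[t y] g] [[t' y'] g'] d [/= /andP[ta _] <- _ _ _].
    have t0 := le_trans a0 ta.
    by rewrite -!BxE //=; split; exact: b_ge.
  exact: bounded_lipschitz_smooth.
- exact: (bounded_lipschitz_smooth _ _ _ (smooth_derive _ Bx_smooth)).
- exact: (bounded_lipschitz_smooth _ _ _ (smooth_derive _ Bx_smooth)).
- exact: bounded_lipschitz_last.
Qed.

Lemma on_fields_derivable2 f (Y : R -> 'rV[R]_2) (G : R -> R) a :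
  rational_rate f -> 0 <= a -> smooth Y -> smooth G ->
  derivable2 (fun s => on_fields f (s, Y s) (G s)) a.
Proof.
move=> fr a0 Ys Gs; apply: (fr _ (derivable2 ^~ a)).
- by move=> f1 f2; exact: derivable2B.
- by move=> f1 f2; exact: derivable2M.
- exact: (derivable2_comp _ (smooth_coord 0 Ex_smooth) Ys).
- exact: (derivable2_comp _ (smooth_coord 1 Ex_smooth) Ys).
- apply: derivable2V; first by rewrite -BxE //=; exact: b_neq0.
  exact: derivable2_comp.
- exact: (derivable2_comp _ (smooth_derive (spatial 0) Bx_smooth) Ys).
- exact: (derivable2_comp _ (smooth_derive (spatial 1) Bx_smooth) Ys).
- exact: derivable2_smooth.
Qed.

(** The equation is only given inside the interval; it extends to the end points
    because both sides are continuous there, up to t0 = 0 included, as b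
    does not vanish. *)
Lemma rate_consistent f (u G : R -> R) (Y : R -> 'rV[R]_2) t0 t1 :
  rational_rate f -> 0 <= t0 -> t0 < t1 -> smooth u -> smooth G -> smooth Y ->
  (forall s, t0 < s < t1 -> 'D_1 u s = on_fields f (s, Y s) (G s)) ->
  (forall s, t0 <= s <= t1 -> 'D_1 u s = on_fields f (s, Y s) (G s)) /\
  exists C d : R, [/\ 0 <= C, 0 < d & forall h t, 0 < h < d -> t0 <= t -> t + h <= t1 ->
    let k := h / (2 * gamma) in
    `|u t + (1 - gamma) * h * 'D_1 u t + gamma * h *
        on_fields f (t + k, Y t + k *: 'D_1 Y t) (G t + k * 'D_1 G t)
       - u (t + h)| <= C * h ^+ 3].
Proof.
move=> fr t00 t01 us Gs Ys inside.
pose r (s : R) : R := 'D_1 u s - on_fields f (s, Y s) (G s).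
have r2 s : 0 <= s -> derivable2 r s.
  move=> s0; apply: derivable2B; last exact: on_fields_derivable2.
  by apply: derivable2_smooth; exact: smooth_derive.
have r0 s : t0 < s < t1 -> r s = 0 by move=> sI; rewrite /r inside // subrr.
have closed s : t0 <= s <= t1 -> 'D_1 u s = on_fields f (s, Y s) (G s).
  move=> /andP[s0 s1]; apply/eqP; rewrite -subr_eq0 -/(r s); apply/eqP.
  have rc := derivable2_continuous (r2 s (le_trans t00 s0)).
  have [s1'|st1] := ltP s t1; last first.
    have -> : s = t1 by apply/eqP; rewrite eq_le s1 st1.
    apply: (continuous_zero_left t01) r0.
    by apply: derivable2_continuous; apply: r2; rewrite (le_trans t00) // ltW.
  (* The point t0, like any s < t1, is approached from the right. *)
  apply: continuous_zero rc _ => d d0.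
  set m := Num.min (s + d / 2) ((s + t1) / 2).
  have m1 : m <= s + d / 2 by rewrite ge_min lexx.
  have m2 : m <= (s + t1) / 2 by rewrite ge_min lexx orbT.
  have m3 : s < m by rewrite lt_min; lra.
  by exists m; [rewrite ltr_norml; lra|apply: r0; lra].
split=> //.
have g0 := @gamma_gt0 R.
have k0 : 0 < (2 * @gamma R)^-1 by rewrite invr_gt0 mulr_gt0.
have gk : gamma * (2 * @gamma R)^-1 = 2^-1 by field; rewrite gt_eqF.
have [C [d [C0 d0 H]]] := two_stage_consistent
  (Psi := fun p => on_fields f p.1 p.2) g0 k0 gk t01 us Gs Ys
  (fun M M0 => on_fields_lipschitz (t1 + 1) fr t00 M0) closed
  (r2 _ (le_trans t00 (ltW t01))).
exists C, d; split => // h t hI ht th /=; rewrite ![h / _]mulrC.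
exact: H.
Qed.

Section Potential.
Context (phi : R -> 'rV[R]_2 -> R).
Hypothesis E_potential : forall t x, 0 <= t ->
  differentiable (phi t) x /\ E t x = - grad (phi t) x.

(** Symmetry of the second derivatives of the potential. *)
Lemma curl_free t y : 0 <= t ->
  'D_(delta_mx 0 0) (fun x => E t x 0 1) y = 'D_(delta_mx 0 1) (fun x => E t x 0 0) y.
Proof.
move=> t0.
have gE i : (fun z => 'D_(delta_mx 0 i) (phi t) z) = - (fun z => E t z 0 i).
  apply/funext => z; have [_ Ez] := E_potential z t0.
  by rewrite !fctE Ez !mxE opprK.
have Ed i := E_coord_differentiable y i t0.
have gd i : differentiable (fun z => 'D_(delta_mx 0 i) (phi t) z) y.
  by rewrite gE; exact: differentiableN.
have := derive_comm (fun z => (E_potential z t0).1) (gd 1) (gd 0).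
rewrite !gE !deriveN; [|exact: diff_derivable..].
by move=> /oppr_inj.
Qed.

(** The divergence of the drift - E^perp / b is the curl of E over b, which
    vanishes, plus E^perp . grad b / b^2, which is minus the dot product of
    perp grad b with E, over b^2. *)
Lemma gyrokinetic_rhsE t y g : 0 <= t ->
  gyrokinetic_rhs E b t (y, g) = (limit_U E b t y g, limit_T E b t y g).
Proof.
move=> t0; have bn := b_neq0 y t0.
have Ed i := E_coord_differentiable y i t0.
have bd := b_differentiable y t0.
have dE i j : is_derive y (delta_mx 0 j) (fun x => E t x 0 i)
    ('D_(delta_mx 0 j) (fun x => E t x 0 i) y).
  by apply: derivableP; exact: diff_derivable.
have db j : is_derive y (delta_mx 0 j) (fun x => (b t x)^-1)
    (- (b t y) ^- 2 *: 'D_(delta_mx 0 j) (b t) y).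
  have bdv := diff_derivable (v := delta_mx 0 j) bd.
  by apply: DeriveDef; [exact: derivableV|exact: deriveV].
have D0 : 'D_(delta_mx 0 0) (fun x => drift E b t x 0 0) y =
    (b t y)^-1 * 'D_(delta_mx 0 0) (fun x => E t x 0 1) y
    - E t y 0 1 * grad (b t) y 0 0 / b t y ^+ 2.
  have := is_deriveM (db 0) (dE 1 0).
  move=> /(@derive_val _ _ _ _ _ _ _) /=.
  rewrite (_ : (fun x => drift E b t x 0 0) =
      (fun x => (b t x)^-1) * (fun x => E t x 0 1)); last first.
    by apply/funext => x; rewrite /drift !mxE /= mulNr mulrN opprK.
  move=> ->; rewrite /grad mxE /GRing.scale /=; field; exact: bn.
have D1 : 'D_(delta_mx 0 1) (fun x => drift E b t x 0 1) y =
    - (b t y)^-1 * 'D_(delta_mx 0 1) (fun x => E t x 0 0) y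
    + E t y 0 0 * grad (b t) y 0 1 / b t y ^+ 2.
  have := is_deriveN (is_deriveM (db 1) (dE 0 1)).
  move=> /(@derive_val _ _ _ _ _ _ _) /=.
  rewrite (_ : (fun x => drift E b t x 0 1) =
      - ((fun x => (b t x)^-1) * (fun x => E t x 0 0))); last first.
    by apply/funext => x; rewrite /drift !mxE /= mulNr.
  move=> ->; rewrite /grad mxE /GRing.scale /=; field; exact: bn.
have divE : divergence (drift E b t) y = 'D_(delta_mx 0 0) (fun x => drift E b t x 0 0) y
   + 'D_(delta_mx 0 1) (fun x => drift E b t x 0 1) y.
  by rewrite /divergence big_ord_recl big_ord1 (_ : lift _ _ = 1) //; apply: val_inj.
congr pair.
  rewrite /limit_U grad_ln_bE // /drift /perp_grad; set G := grad _ _.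
  by apply: rV2P; rewrite !mxE /=; field.
rewrite divE D0 D1 curl_free // /limit_T dotE /perp_grad.
by set G := grad _ _; rewrite !mxE /=; field.
Qed.

(** The extension Z gives a meaning to the solution at the node t + h / (2
    gamma), which can exceed t1. Each of the three components of the state
    is a two-stage scheme for its own rate. *)
Lemma limit_step_consistent :
  consistent_of_order 2 (limit_step E b) (gyrokinetic_rhs E b).
Proof.
move=> t0 t1 z t00 t01 [Z Zs zZ] zd.
pose Y (s : R) : 'rV[R]_2 := (Z s).1; pose G (s : R) : R := (Z s).2.
have Ys : smooth Y := smooth_fst Zs; have Gs : smooth G := smooth_snd Zs.
have ZE s : t0 < s < t1 -> 'D_1 Z s = (limit_U E b s (Y s) (G s), limit_T E b s (Y s) (G s)).
  move=> sI; have s0 : 0 <= s by case/andP: sI => s0 _; rewrite (le_trans t00) // ltW.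
  rewrite -gyrokinetic_rhsE // -surjective_pairing -zZ; last first.
    by rewrite /= in_itv /=; lra.
  apply: (@derive_val _ _ _ _ _ _ _ _).
  apply: (near_eq_is_derive _ (zd s sI)).
  have : s \in `]t0, t1[%R by rewrite in_itv.
  move=> /near_in_itvoo; apply: filterS => q; rewrite in_itv /= => qI.
  by apply: zZ; rewrite /= in_itv /=; lra.
have YE s : t0 < s < t1 -> 'D_1 Y s = limit_U E b s (Y s) (G s).
  move=> sI; have := ZE s sI => /(congr1 fst) /= <-.
  apply: (@derive_linear_comp _ _ _ _ (@fst _ _) Z); last exact: smooth_differentiable.
  by move=> q; exact: cvg_fst.
have GE s : t0 < s < t1 -> 'D_1 G s = limit_T E b s (Y s) (G s).
  move=> sI; have := ZE s sI => /(congr1 snd) /= <-.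
  apply: (@derive_linear_comp _ _ _ _ (@snd _ _) Z); last exact: smooth_differentiable.
  by move=> q; exact: cvg_snd.
have pos s : t0 < s < t1 -> 0 <= s.
  by case/andP => s0 _; rewrite (le_trans t00) // ltW.
have Y0E s : t0 < s < t1 ->
    'D_1 (fun s => Y s 0 0) s = on_fields rateU0 (s, Y s) (G s).
  by move=> sI; rewrite derive_coord // YE // limit_U0E // pos.
have Y1E s : t0 < s < t1 ->
    'D_1 (fun s => Y s 0 1) s = on_fields rateU1 (s, Y s) (G s).
  by move=> sI; rewrite derive_coord // YE // limit_U1E // pos.
have GE' s : t0 < s < t1 -> 'D_1 G s = on_fields rateT (s, Y s) (G s).
  by move=> sI; rewrite GE // limit_TE // pos.
have [E0 [C0 [d0 [C00 d00 H0]]]] :=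
  rate_consistent rational_rateU0 t00 t01 (smooth_coord 0 Ys) Gs Ys Y0E.
have [E1 [C1 [d1 [C10 d10 H1]]]] :=
  rate_consistent rational_rateU1 t00 t01 (smooth_coord 1 Ys) Gs Ys Y1E.
have [E2 [C2 [d2 [C20 d20 H2]]]] :=
  rate_consistent rational_rateT t00 t01 Gs Gs Ys GE'.
exists (C0 + C1 + C2); near=> h => t tt0 tht1.
have h0 : 0 < h by near: h; exact: nbhs_right_gt.
have hd0 : 0 < h < d0 by rewrite h0 /=; near: h; exact: nbhs_right_lt.
have hd1 : 0 < h < d1 by rewrite h0 /=; near: h; exact: nbhs_right_lt.
have hd2 : 0 < h < d2 by rewrite h0 /=; near: h; exact: nbhs_right_lt.
have h3 : 0 <= h ^+ 3 by rewrite exprn_ge0 // ltW.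
have tI : t0 <= t <= t1 by rewrite tt0 /=; lra.
have tp : 0 <= t by exact: le_trans tt0.
pose k := h / (2 * @gamma R).
have kp : 0 <= t + k.
  by rewrite addr_ge0 // divr_ge0 // ?mulr_ge0 // ltW // gamma_gt0.
rewrite !zZ; [|by rewrite /= in_itv /=; lra..].
have YtE : 'D_1 Y t = limit_U E b t (Y t) (G t).
  apply: rV2P; first by rewrite -derive_coord // E0 // limit_U0E.
  by rewrite -derive_coord // E1 // limit_U1E.
have GtE : 'D_1 G t = limit_T E b t (Y t) (G t) by rewrite E2 // limit_TE.
have := H2 h t hd2 tt0 tht1; have := H1 h t hd1 tt0 tht1.
have := H0 h t hd0 tt0 tht1; rewrite /= -/k !derive_coord // YtE GtE.
rewrite -limit_U0E // -limit_U1E // -limit_TE // => b0' b1' b2'.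
rewrite (surjective_pairing (Z t)) -/(Y t) -/(G t) /limit_step -/k.
rewrite prod_normE /= ge_max; apply/andP; split.
  apply: norm_rV2_le; rewrite combination_coord.
    by apply: (le_trans b0'); apply: ler_wpM2r => //; lra.
  by apply: (le_trans b1'); apply: ler_wpM2r => //; lra.
by apply: (le_trans b2'); apply: ler_wpM2r => //; lra.
Unshelve. all: by end_near. Qed.

End Potential.
End Fields.

Theorem proposition2p4 (R : realType)
    (E : R -> 'rV[R]_2 -> 'rV[R]_2) (b : R -> 'rV[R]_2 -> R)
    (phi : R -> 'rV[R]_2 -> R) (chi : R -> 'rV[R]_2 -> R) (b0 : R)
    (E_smooth : smooth_on [set p : R * 'rV[R]_2 | 0 <= p.1]
                  (fun p => E p.1 p.2))
    (b_smooth : smooth_on [set p : R * 'rV[R]_2 | 0 <= p.1]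
                  (fun p => b p.1 p.2))
    (b0_gt0 : 0 < b0)
    (b_ge : forall t x, 0 <= t -> b0 <= b t x)
    (E_potential : forall t x, 0 <= t ->
       differentiable (phi t) x /\ E t x = - grad (phi t) x)
    (chi_cont : continuous (fun p : R * 'rV[R]_2 => chi p.1 p.2))
    (chi_kin : forall w : 'rV[R]_2, chi (2^-1 * dot w w) w = 0)
    (chi_lim : forall e : R,
       chi e w @[w --> (0 : 'rV[R]_2)^'] --> e)
    (chi_bnd : forall (e : R) (w : 'rV[R]_2), 0 <= e -> 0 <= chi e w <= e)
    (dt T : R) (dt_gt0 : 0 < dt) (T_gt0 : 0 < T)
    (x w : R -> nat -> 'rV[R]_2) (e : R -> nat -> R)
    (scheme : forall (eps : R) (n : nat), 0 < eps ->
       (n < Num.truncn (T / dt))%N ->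
       scheme_step E b chi eps dt (n%:R * dt)
         (x eps n) (w eps n) (e eps n)
         (x eps n.+1) (w eps n.+1) (e eps n.+1))
    (bounded : forall n : nat, (1 <= n <= Num.truncn (T / dt))%N ->
       exists M : R, forall eps : R, 0 < eps ->
         [/\ `|x eps n| <= M, `|eps *: w eps n| <= M & `|e eps n| <= M])
    (y0 w0 : 'rV[R]_2) (g0 : R)
    (x_cvg0 : x eps 0%N @[eps --> 0^'+] --> y0)
    (w_cvg0 : w eps 0%N @[eps --> 0^'+] --> w0)
    (e_cvg0 : e eps 0%N @[eps --> 0^'+] --> g0) :
  (exists (y : nat -> 'rV[R]_2) (g : nat -> R),
     (forall n : nat, (1 <= n <= Num.truncn (T / dt))%N ->
        x eps n @[eps --> 0^'+] --> y n /\ e eps n @[eps --> 0^'+] --> g n) /\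
     (forall n : nat, (1 <= n)%N -> (n <= Num.truncn (T / dt) - 1)%N ->
        (y n.+1, g n.+1) = limit_step E b dt (n%:R * dt) (y n, g n))) /\
  consistent_of_order 2 (limit_step E b) (gyrokinetic_rhs E b).
Proof.
case: E_smooth => Ex Exs ExE; case: b_smooth => Bx Bxs BxE.
split.
  exact: (scheme_cvg Exs Bxs ExE BxE b0_gt0 b_ge chi_cont chi_lim dt_gt0 scheme
    x_cvg0 w_cvg0 e_cvg0).
exact: (limit_step_consistent Exs Bxs ExE BxE b0_gt0 b_ge E_potential).
Qed.
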